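(* Let $n\ge 4$. Any canal space-like hypersurface of hyperbolic type in the Minkowski space $\mathbb{R}^{n+1}_1$ is a Riemannian manifold of quasi-constant sectional curvatures with function $a+k^2<0$.
   Context: QC-manifolds. $(M,g,\xi)$ denotes an $n$-dimensional Riemannian manifold with metric $g$ and a unit vector field $\xi$; $\eta(X)=g(\xi,X)$, and $\Delta(p)=\{X\in T_pM:\eta(X)=0\}$. $(M,g,\xi)$ is a Riemannian manifold of quasi-constant sectional curvatures (Riemannian QC-manifold) if for every $p\in M$ and every 2-plane $E\subset T_pM$ the sectional curvature of $E$ depends only on $p$ and on the angle between $E$ and $\xi$. Equivalently, the curvature tensor has the form $\mathcal R=a\,\pi+b\,\Phi$ for some functions $a,b$ on $M$, where $\pi(X,Y,Z,U)=g(Y,Z)g(X,U)-g(X,Z)g(Y,U)$ and $\Phi(X,Y,Z,U)=g(Y,Z)\eta(X)\eta(U)-g(X,Z)\eta(Y)\eta(U)+g(X,U)\eta(Y)\eta(Z)-g(Y,U)\eta(X)\eta(Z)$ (sign convention: $\mathcal R=c\,\pi$ means constant sectional curvature $c$). The function $k$ is defined by $\nabla_x\xi=k\,x$ for $x\in\Delta$ (when $b\ne0$, $k=\xi(a)/(2b)$), where $\nabla$ is the Levi-Civita connection of $g$. Canal space-like hypersurfaces. $\mathbb{R}^{n+1}_1$ is Minkowski space with scalar product of signature $(n,1)$; products of vectors are scalar products. A hypersurface $M$ of dimension $n$ is space-like if the induced metric is positive definite. A space-like hypersphere with center $z$ and radius $R>0$ is $\{Z:(Z-z)^2=-R^2\}$.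 A sphere of codimension two is an $(n-1)$-dimensional cross-section $S^{n-1}$ of a space-like hypersphere with a hyperplane. A canal space-like hypersurface is a space-like hypersurface $M=\{S^{n-1}(s)\}$, $s\in J\subset\mathbb R$, which is a one-parameter family of spheres of codimension two (spherical generators) such that the normals to $M$ at the points of any fixed generator $S^{n-1}(s)$ pass through a fixed point $z(s)$. Its position vector $Z$ then satisfies $(Z-z(s))^2=-R^2(s)$ and $(Z-z(s))\,z'(s)=R(s)R'(s)$, with $R(s)>0$. Such an $M$ is endowed with the induced metric $g$ and the unit tangent vector field $\xi=\frac{t-R'N}{\sqrt{(t-R'N)^2}}$, where $t=z'$ and $N=-\frac{Z-z}{R}$ is the unit normal ($N^2=-1$). It is of hyperbolic type if the curve of centers $z(s)$ is space-like. *)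

(* Defs.v *)
From HB Require Import structures.
From mathcomp Require Import all_boot all_order all_algebra.
From mathcomp Require Import all_classical all_reals all_analysis.
Set Implicit Arguments.
Unset Strict Implicit.
Unset Printing Implicit Defensive.
Import Order.TTheory GRing.Theory Num.Theory.
Import numFieldNormedType.Exports.
Local Open Scope classical_set_scope.
Local Open Scope ring_scope.

(* C^oo on U: every iterated directional derivative is (Frechet)
   differentiable at every point of U. *)
Definition smooth_on (R : realType) (V W : normedModType R) (U : set V)
    (f : V -> W) : Prop :=
  forall (s : seq V) (u : V), U u ->
    differentiable (foldr (fun v h => 'D_v h) f s) u.

Definition basis_vec (R : realType) (n : nat) (i : 'I_n) : 'rV[R]_n :=
  delta_mx 0 i.

(* Riemannian geometry on a coordinate domain of R^n.  A metric is given by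
   its matrix G u at the point u, and tangent vectors are the row vectors of
   their coordinates. *)

Definition metric_ip (R : realType) (n : nat) (G : 'rV[R]_n -> 'M[R]_n)
    (u x y : 'rV[R]_n) : R :=
  (x *m G u *m y^T) 0 0.

(* nabla_x y at u, for x and y extended with constant coordinates: the Koszul
   formula, whose bracket terms vanish for such fields. *)
Definition christoffel (R : realType) (n : nat) (G : 'rV[R]_n -> 'M[R]_n)
    (u x y : 'rV[R]_n) : 'rV[R]_n :=
  (\row_m (2^-1 *
     ('D_x (fun v => metric_ip G v y (basis_vec R m)) u
      + 'D_y (fun v => metric_ip G v x (basis_vec R m)) u
      - 'D_(basis_vec R m) (fun v => metric_ip G v x y) u)))
  *m invmx (G u).

Definition levi_civita (R : realType) (n : nat) (G : 'rV[R]_n -> 'M[R]_n)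
    (x : 'rV[R]_n) (V : 'rV[R]_n -> 'rV[R]_n) (u : 'rV[R]_n) : 'rV[R]_n :=
  'D_x V u + christoffel G u x (V u).

(* R(x, y)w = nabla_x nabla_y w - nabla_y nabla_x w, the vectors being extended
   with constant coordinates, so that [x, y] = 0. *)
Definition riemann_op (R : realType) (n : nat) (G : 'rV[R]_n -> 'M[R]_n)
    (u x y w : 'rV[R]_n) : 'rV[R]_n :=
  levi_civita G x (levi_civita G y (fun=> w)) u
  - levi_civita G y (levi_civita G x (fun=> w)) u.

Definition riemann (R : realType) (n : nat) (G : 'rV[R]_n -> 'M[R]_n)
    (u x y z w : 'rV[R]_n) : R :=
  metric_ip G u (riemann_op G u x y z) w.

Definition pi_tensor (R : realType) (n : nat) (G : 'rV[R]_n -> 'M[R]_n)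
    (u x y z w : 'rV[R]_n) : R :=
  let g := metric_ip G u in
  g y z * g x w - g x z * g y w.

Definition Phi_tensor (R : realType) (n : nat) (G : 'rV[R]_n -> 'M[R]_n)
    (xi : 'rV[R]_n -> 'rV[R]_n) (u x y z w : 'rV[R]_n) : R :=
  let g := metric_ip G u in
  let eta := metric_ip G u (xi u) in
  g y z * eta x * eta w - g x z * eta y * eta w
  + g x w * eta y * eta z - g y w * eta x * eta z.

Definition orthonormal_pair (R : realType) (n : nat) (G : 'rV[R]_n -> 'M[R]_n)
    (u x y : 'rV[R]_n) : Prop :=
  [/\ metric_ip G u x x = 1, metric_ip G u y y = 1 & metric_ip G u x y = 0].

(* Sectional curvature of the plane with orthonormal basis x, y. *)
Definition sectional (R : realType) (n : nat) (G : 'rV[R]_n -> 'M[R]_n)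
    (u x y : 'rV[R]_n) : R :=
  riemann G u x y y x.

(* Angle between the unit vector xi and the plane with orthonormal basis x, y:
   its cosine is the length of the orthogonal projection of xi. *)
Definition plane_angle (R : realType) (n : nat) (G : 'rV[R]_n -> 'M[R]_n)
    (xi : 'rV[R]_n -> 'rV[R]_n) (u x y : 'rV[R]_n) : R :=
  let p := metric_ip G u (xi u) x *: x + metric_ip G u (xi u) y *: y in
  acos (Num.sqrt (metric_ip G u p p)).

(* Minkowski space R^{n+1}_1, of signature (n, 1). *)
Definition mink (R : realType) (n : nat) (x y : 'rV[R]_n.+1) : R :=
  \sum_(i < n) x 0 (widen_ord (leqnSn n) i) * y 0 (widen_ord (leqnSn n) i)
  - x 0 ord_max * y 0 ord_max.

(* X is a diffeomorphism of the open set U onto a relatively open subset of M,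
   with injective differential. *)
Definition local_param (R : realType) (n : nat) (M : set 'rV[R]_n.+1)
    (U : set 'rV[R]_n) (X : 'rV[R]_n -> 'rV[R]_n.+1) : Prop :=
  [/\ open U,
      smooth_on U X,
      forall u, U u -> injective ('d X u),
      set_inj U X &
      forall V : set 'rV[R]_n, open V -> V `<=` U ->
        exists2 W : set 'rV[R]_n.+1, open W & X @` V = M `&` W].

Definition hypersurface (R : realType) (n : nat) (M : set 'rV[R]_n.+1) : Prop :=
  forall p, M p -> exists U X, local_param M U X /\ (X @` U) p.

Definition tangent (R : realType) (n : nat) (M : set 'rV[R]_n.+1)
    (p v : 'rV[R]_n.+1) : Prop :=
  exists U X u (x : 'rV[R]_n),
    [/\ local_param M U X, U u, X u = p & 'd X u x = v].

Definition spacelike_hypersurface (R : realType) (n : nat)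
    (M : set 'rV[R]_n.+1) : Prop :=
  hypersurface M /\
  forall p v, M p -> tangent M p v -> v != 0 -> 0 < mink v v.

Definition smooth_field (R : realType) (n : nat) (M : set 'rV[R]_n.+1)
    (V : 'rV[R]_n.+1 -> 'rV[R]_n.+1) : Prop :=
  forall U X, local_param M U X -> smooth_on U (V \o X).

Definition unit_tangent_field (R : realType) (n : nat) (M : set 'rV[R]_n.+1)
    (V : 'rV[R]_n.+1 -> 'rV[R]_n.+1) : Prop :=
  smooth_field M V /\
  forall p, M p -> tangent M p (V p) /\ mink (V p) (V p) = 1.

(* The induced metric in the coordinates of X. *)
Definition first_form (R : realType) (n : nat)
    (X : 'rV[R]_n -> 'rV[R]_n.+1) (u : 'rV[R]_n) : 'M[R]_n :=
  \matrix_(i, j) mink ('d X u (basis_vec R i)) ('d X u (basis_vec R j)).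

(* Coordinates, in the parametrization X, of a field V tangent to the
   hypersurface. *)
Definition field_coord (R : realType) (n : nat)
    (X : 'rV[R]_n -> 'rV[R]_n.+1) (V : 'rV[R]_n.+1 -> 'rV[R]_n.+1)
    (u : 'rV[R]_n) : 'rV[R]_n :=
  (\row_j mink (V (X u)) ('d X u (basis_vec R j))) *m invmx (first_form X u).

(* (M, g, xi), with g the induced metric, is a Riemannian manifold of
   quasi-constant sectional curvatures. *)
Definition QC_manifold (R : realType) (n : nat) (M : set 'rV[R]_n.+1)
    (xi : 'rV[R]_n.+1 -> 'rV[R]_n.+1) : Prop :=
  [/\ spacelike_hypersurface M,
      unit_tangent_field M xi &
      forall U X u, local_param M U X -> U u ->
        let G := first_form X in
        let xi' := field_coord X xi in
        forall x y x' y', orthonormal_pair G u x y ->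
          orthonormal_pair G u x' y' ->
          plane_angle G xi' u x y = plane_angle G xi' u x' y' ->
          sectional G u x y = sectional G u x' y'].

(* a, b and k are the functions on M such that R = a pi + b Phi and
   nabla_x xi = k x for every x orthogonal to xi. *)
Definition QC_functions (R : realType) (n : nat) (M : set 'rV[R]_n.+1)
    (xi : 'rV[R]_n.+1 -> 'rV[R]_n.+1) (a b k : 'rV[R]_n.+1 -> R) : Prop :=
  forall U X u, local_param M U X -> U u ->
    let G := first_form X in
    let xi' := field_coord X xi in
    (forall x y z w, riemann G u x y z w
       = a (X u) * pi_tensor G u x y z w
         + b (X u) * Phi_tensor G xi' u x y z w) /\
    (forall x, metric_ip G u (xi' u) x = 0 ->
       levi_civita G x xi' u = k (X u) *: x).

Definition spacelike_hypersphere (R : realType) (n : nat) (c : 'rV[R]_n.+1)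
    (r : R) : set 'rV[R]_n.+1 :=
  [set Z | mink (Z - c) (Z - c) = - r ^+ 2].

Definition hyperplane (R : realType) (n : nat) (w : 'rV[R]_n.+1) (d : R) :
    set 'rV[R]_n.+1 :=
  [set Z | mink Z w = d].

(* Transversality makes the section a submanifold of dimension n - 1: it
   rules out the sections reduced to a point by a tangent hyperplane. *)
Definition codim2_sphere (R : realType) (n : nat) (S : set 'rV[R]_n.+1) :
    Prop :=
  exists c r w d,
    [/\ 0 < r, w != 0, S = spacelike_hypersphere c r `&` hyperplane w d,
        S !=set0 & forall Z, S Z -> \rank (col_mx (Z - c) w) = 2%N].

(* M is the canal space-like hypersurface with spherical generators S s,
   centers z s and radii rad s, for s in J.  In canal_normal, the normal line
   at Z passes through z s when Z - z s is orthogonal to all tangent vectors. *)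
Record canal_hypersurface (R : realType) (n : nat) (M : set 'rV[R]_n.+1)
    (J : set R) (S : R -> set 'rV[R]_n.+1) (z : R -> 'rV[R]_n.+1)
    (rad : R -> R) : Prop := {
  canal_spacelike : spacelike_hypersurface M;
  canal_open : open J;
  canal_generators : M = \bigcup_(s in J) S s;
  canal_sphere : forall s, J s -> codim2_sphere (S s);
  canal_normal : forall s Z v, J s -> S s Z -> tangent M Z v ->
    mink (Z - z s) v = 0;
  canal_center_smooth : smooth_on J (z : R^o -> _);
  canal_radius_smooth : smooth_on J (rad : R^o -> R^o);
  canal_radius_gt0 : forall s, J s -> 0 < rad s;
  canal_radius : forall s Z, J s -> S s Z ->
    mink (Z - z s) (Z - z s) = - rad s ^+ 2;
  canal_envelope : forall s Z, J s -> S s Z ->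
    mink (Z - z s) (derive1 z s) = rad s * derive1 rad s
}.

Definition hyperbolic_type (R : realType) (n : nat) (J : set R)
    (z : R -> 'rV[R]_n.+1) : Prop :=
  forall s, J s -> 0 < mink (derive1 z s) (derive1 z s).

Definition canal_unit_normal (R : realType) (n : nat) (z : R -> 'rV[R]_n.+1)
    (rad : R -> R) (s : R) (Z : 'rV[R]_n.+1) : 'rV[R]_n.+1 :=
  - ((rad s)^-1 *: (Z - z s)).

Definition canal_direction (R : realType) (n : nat) (z : R -> 'rV[R]_n.+1)
    (rad : R -> R) (s : R) (Z : 'rV[R]_n.+1) : 'rV[R]_n.+1 :=
  let v := derive1 z s - derive1 rad s *: canal_unit_normal z rad s Z in
  (Num.sqrt (mink v v))^-1 *: v.

(* xi is the vector field of the canal hypersurface: at a point lying on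
   several generators the formula has to give the same vector. *)
Definition canal_field (R : realType) (n : nat) (M : set 'rV[R]_n.+1)
    (J : set R) (S : R -> set 'rV[R]_n.+1) (z : R -> 'rV[R]_n.+1)
    (rad : R -> R) (xi : 'rV[R]_n.+1 -> 'rV[R]_n.+1) : Prop :=
  smooth_field M xi /\
  forall s Z, J s -> S s Z -> xi Z = canal_direction z rad s Z.

(* Main.v *)
Require Import Defs.
From mathcomp Require Import all_boot all_order all_algebra.
From mathcomp Require Import all_classical all_reals all_analysis.
From mathcomp Require Import perm ring lra.
Import Order.TTheory GRing.Theory Num.Theory.
Import numFieldNormedType.Exports.
Local Open Scope classical_set_scope.
Local Open Scope ring_scope.
Set Implicit Arguments.
Unset Strict Implicit.
Unset Printing Implicit Defensive.

(** Let [Z] be a point of the generator [S s], with center [z] and radius [R].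
    By hypothesis [N = - (Z - z) / R] is a time-like unit normal at [Z].  The
    proof rests on freezing [s] and differentiating only along the generator,
    where [z] and [R] are constants, so that nearby generators are never
    compared.

    The tangent space of the generator at [Z] is the orthogonal complement of
    [Z - z] and [t = z'] (generator_curve): the sphere has curves in all the
    directions orthogonal to [Z - c] and to the normal [w] of its hyperplane
    (codim2_sphere_curve), such directions are orthogonal to [Z - z] and [t] by
    the radius and envelope conditions, and the dimensions agree since [Z - z]
    is time-like and [t] space-like.  Among tangent vectors of [M], it is also
    the orthogonal complement of [xi].  Curves of the generator are moved to
    the coordinates of a chart by lift_curve.

    Along the generator two identities are differentiated.  From
    [<D_p X, X - z> = 0] one obtains that the second fundamental form [h]
    equals [1 / R] times the metric as soon as one argument is orthogonal to
    [xi] (second_form_generator); by symmetry of [h],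
    [h = lam g + mu eta (x) eta] with [lam = 1 / R] (second_formE).  From the
    formula of [xi], which is affine in the position on a generator, one obtains
    that [nabla_x xi = k x] for [x] orthogonal to [xi], with
    [k = R' / (R (t^2 + R'^2)^(1/2))] (levi_civita_field).

    The Gauss equation for a time-like normal reads
    [R(x, y, w, v) = h(x, w) h(y, v) - h(y, w) h(x, v)] (gauss_equation); its
    proof uses the symmetry of iterated derivatives (derive_commute) and the
    description of the covariant derivative as the tangential part of the flat
    one (levi_civitaP).  With the form of [h] it gives
    [R = - lam^2 pi - lam mu Phi], so that [a = - 1 / R^2] and
    [a + k^2 = - t^2 / (R^2 (t^2 + R'^2)) < 0] because [t] is space-like.  The
    sectional curvature of a plane is then [a + b (eta x ^ 2 + eta y ^ 2)],
    where the sum of squares is the squared cosine of the angle with [xi].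

    Since [b] has to be a function on [M], the number [mu] must not depend on
    the chart: it is read off the derivative of the field [xi] in its own
    direction, which is the same in all charts (derive_field_param). *)

(** * Orthogonality in Minkowski space *)

Section MinkowskiAlgebra.
Variables (R : realType) (n : nat).
Implicit Types x y v w : 'rV[R]_n.+1.

Definition mink_gram : 'M[R]_n.+1 :=
  diag_mx (\row_i (if i == ord_max then -1 else 1)).

Definition mink_dual m (W : 'M[R]_(m, n.+1)) : 'M[R]_(n.+1, m) :=
  mink_gram *m W^T.

Lemma mink_dualE x y : mink x y = (x *m mink_dual y) 0 0.
Proof.
rewrite /mink_dual mulmxA mxE big_ord_recr /=; congr (_ + _).
  apply: eq_bigr => i _; rewrite mul_mx_diag !mxE -(inj_eq val_inj) /=.
  by rewrite ltn_eqF ?mulr1.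
by rewrite mul_mx_diag !mxE eqxx mulrN1 mulNr.
Qed.

Lemma minkC x y : mink x y = mink y x.
Proof.
by rewrite /mink mulrC; congr (_ - _); apply: eq_bigr => i _; rewrite mulrC.
Qed.

Lemma minkDl x1 x2 y : mink (x1 + x2) y = mink x1 y + mink x2 y.
Proof. by rewrite !mink_dualE mulmxDl mxE. Qed.

Lemma minkZl c x y : mink (c *: x) y = c * mink x y.
Proof. by rewrite !mink_dualE -scalemxAl mxE. Qed.

Lemma minkDr y x1 x2 : mink y (x1 + x2) = mink y x1 + mink y x2.
Proof. by rewrite minkC minkDl !(minkC y). Qed.

Lemma minkZr c y x : mink y (c *: x) = c * mink y x.
Proof. by rewrite minkC minkZl (minkC y). Qed.

Lemma minkNl x y : mink (- x) y = - mink x y.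
Proof. by rewrite -scaleN1r minkZl mulN1r. Qed.

Lemma minkNr x y : mink y (- x) = - mink y x.
Proof. by rewrite minkC minkNl minkC. Qed.

Lemma mink0l y : mink 0 y = 0.
Proof. by rewrite -(scale0r y) minkZl mul0r. Qed.

Lemma mink0r y : mink y 0 = 0.
Proof. by rewrite minkC mink0l. Qed.

(** Expanding the nonnegative sum of the squares of [y_n v_i - v_n y_i] over
    the space coordinates gives the reverse Cauchy-Schwarz inequality that is
    behind this causal fact. *)
Lemma spacelike_of_orth_timelike y v :
  mink y y < 0 -> mink y v = 0 -> v != 0 -> 0 < mink v v.
Proof.
rewrite /mink; set W := widen_ord _; set A := \sum_(i < n) _.
set a := y 0 ord_max; set b := v 0 ord_max.
move=> yy; set C := \sum_(i < n) _ => /eqP; rewrite subr_eq0 => /eqP yv v0.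
set B := \sum_(i < n) _.
have key : 0 <= a ^+ 2 * B - 2 * a * b * C + b ^+ 2 * A.
  rewrite /A /B /C !mulr_sumr -sumrN -!big_split /=.
  apply: sumr_ge0 => i _.
  rewrite (_ : _ + _ = (a * v 0 (W i) - b * y 0 (W i)) ^+ 2) ?sqr_ge0 //; ring.
have A0 : 0 <= A by apply: sumr_ge0 => i _; rewrite -expr2 sqr_ge0.
have B0 : 0 <= B by apply: sumr_ge0 => i _; rewrite -expr2 sqr_ge0.
have a2 : 0 < a ^+ 2 by nra.
rewrite yv in key.
have [b0|bn0] := eqVneq b 0; last first.
  have b2 : 0 < b ^+ 2 by rewrite lt_def sqrf_eq0 bn0 sqr_ge0.
  have : 0 < a ^+ 2 * (B - b * b) by nra.
  by rewrite pmulr_rgt0.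
rewrite b0 mulr0 subr0 lt_def B0 andbT; apply: contra v0 => B00.
apply/eqP/rowP => i; rewrite mxE.
case: (unliftP ord_max i) => [j|] ->; last exact: b0.
have /eqP : v 0 (W j) * v 0 (W j) = 0.
  apply/eqP; move: B00; rewrite psumr_eq0.
    by move=> /allP /(_ j); rewrite mem_index_enum /= => ->.
  by move=> k _; rewrite -expr2 sqr_ge0.
rewrite mulf_eq0 orbb => /eqP <-; congr (v 0 _).
by apply: val_inj; rewrite /= /bump leqNgt ltn_ord.
Qed.

(** A plane containing a time-like vector is Lorentzian, so its Gram
    determinant is negative. *)
Lemma lorentz_gram_lt0 y w : mink y y < 0 -> \rank (col_mx y w) = 2%N ->
  mink w w * mink y y - mink y w ^+ 2 < 0.
Proof.
move=> yy rk; set v := w - (mink y w / mink y y) *: y.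
have yy0 : mink y y != 0 by rewrite lt_eqF.
have v0 : v != 0.
  apply/eqP => v0.
  have wy : w = (mink y w / mink y y) *: y.
    by apply/eqP; rewrite -subr_eq0 -/v v0.
  have : (\rank (col_mx y w) <= 1)%N.
    rewrite -addsmxE (leq_trans _ (rank_leq_row y)) // mxrankS //.
    by rewrite addsmx_sub submx_refl wy scalemx_sub.
  by rewrite rk.
have yv : mink y v = 0.
  by rewrite /v minkDr minkNr minkZr divfK // subrr.
have := spacelike_of_orth_timelike yy yv v0.
rewrite /v minkDl minkNl minkZl -/v yv mulr0 subr0.
rewrite minkDr minkNr minkZr (minkC w y).
move=> h; have : (mink w w - mink y w / mink y y * mink y w) * mink y y < 0.
  by rewrite pmulr_rlt0.
by rewrite mulrBl mulrAC divfK // expr2.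
Qed.

Lemma mink_gram_unit : mink_gram \in unitmx.
Proof.
rewrite unitmxE det_diag unitfE prodf_seq_neq0; apply/allP => i _ /=.
by rewrite mxE; case: ifP => _; rewrite ?oppr_eq0 oner_neq0.
Qed.

Lemma rank_mink_dual m (W : 'M[R]_(m, n.+1)) : \rank (mink_dual W) = \rank W.
Proof.
rewrite -mxrank_tr trmx_mul trmxK mxrankMfree //.
by rewrite row_free_unit unitmx_tr mink_gram_unit.
Qed.

Definition mink_orth m (W : 'M[R]_(m, n.+1)) : 'M[R]_n.+1 := kermx (mink_dual W).

Lemma rank_mink_orth m (W : 'M[R]_(m, n.+1)) :
  \rank (mink_orth W) = (n.+1 - \rank W)%N.
Proof. by rewrite mxrank_ker rank_mink_dual. Qed.

Lemma mink_orth1P x y : (x <= mink_orth y)%MS <-> mink x y = 0.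
Proof.
rewrite mink_dualE; split=> [/sub_kermxP ->|h]; first by rewrite mxE.
by apply/sub_kermxP/matrixP => i j; rewrite !ord1 h mxE.
Qed.

Lemma mink_orth2P x y w :
  (x <= mink_orth (col_mx y w))%MS <-> mink x y = 0 /\ mink x w = 0.
Proof.
have E : x *m mink_dual (col_mx y w) = row_mx (x *m mink_dual y) (x *m mink_dual w).
  by rewrite /mink_dual tr_col_mx !mul_mx_row.
split=> [/sub_kermxP|[h1 h2]].
  rewrite E -row_mx0 => /eq_row_mx [h1 h2].
  by rewrite !mink_dualE h1 h2 mxE.
apply/sub_kermxP; rewrite E -row_mx0; congr row_mx;
  by apply/sub_kermxP/mink_orth1P.
Qed.

(** The form is nondegenerate, so the orthogonal complement of [W] has the
    complementary dimension: all tangent spaces below are identified in this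
    way from one inclusion and a count of dimensions. *)
Lemma mink_orth_full m p (W : 'M[R]_(m, n.+1)) (T : 'M[R]_(p, n.+1)) :
  (T <= mink_orth W)%MS -> (n.+1 <= \rank T + \rank W)%N ->
  (mink_orth W <= T)%MS.
Proof.
move=> TW rk; rewrite -(geq_leqif (mxrank_leqif_sup TW)) rank_mink_orth.
by rewrite leq_subLR addnC.
Qed.

(** A linear relation would give the squares of the two vectors the same
    sign. *)
Lemma rank_timelike_spacelike y t :
  mink y y < 0 -> 0 < mink t t -> \rank (col_mx y t) = 2%N.
Proof.
move=> yy tt; apply/eqP; rewrite -[_ == _]/(row_free _) -kermx_eq0.
apply/eqP/row_matrixP => i; rewrite row0; set k := row i _.
have : k *m col_mx y t = 0 by rewrite /k -row_mul mulmx_ker row0.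
rewrite -[k]hsubmxK mul_row_col [lsubmx k]mx11_scalar [rsubmx k]mx11_scalar.
rewrite !mul_scalar_mx; set a := lsubmx k 0 0; set b := rsubmx k 0 0 => ab.
have E1 : a *: y = - (b *: t) by apply/eqP; rewrite -addr_eq0 ab.
have E2 : mink (a *: y) (a *: y) = mink (b *: t) (b *: t).
  by rewrite E1 minkNl minkNr opprK.
rewrite !minkZl !minkZr !mulrA -!expr2 in E2.
have a2 := sqr_ge0 a; have b2 := sqr_ge0 b.
have a0 : a ^+ 2 = 0 by nra.
have b0 : b ^+ 2 = 0 by nra.
move/eqP: a0; move/eqP: b0; rewrite !sqrf_eq0 => /eqP -> /eqP ->.
by rewrite !raddf0 row_mx0.
Qed.

End MinkowskiAlgebra.

(** * Directional derivatives *)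

Section DirectionalCalculus.
Variables (R : realType) (V : normedModType R).

Lemma is_derive_estimateP (W : normedModType R) (f : V -> W) (a v : V) (df : W) :
  is_derive a v f df <->
  forall e : R, 0 < e ->
    \forall h \near (0 : R), `|f (h *: v + a) - f a - h *: df| <= e * `|h|.
Proof.
have E (d : W) (h : R) : h != 0 ->
    `|d - h^-1 *: (f (h *: v + a) - f a)| * `|h| = `|f (h *: v + a) - f a - h *: d|.
  move=> h0; rewrite mulrC -normrZ scalerBr scalerA divff // scale1r distrC.
  by [].
split=> [[cf <-] e e0|H].
  have /cvgrPdist_le /(_ e e0) : (fun h => h^-1 *: ((f \o shift a) (h *: v) - f a)) @ 0^' --> 'D_v f a by [].
  rewrite near_withinE; apply: filterS => h /= hP.
  have [->|h0] := eqVneq h 0; first by rewrite !scale0r add0r !subrr !normr0 mulr0.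
  by rewrite -E // ler_pM2r ?normr_gt0 //; exact: hP.
have c : (fun h => h^-1 *: ((f \o shift a) (h *: v) - f a)) @ 0^' --> df.
  apply/cvgrPdist_le => e e0; rewrite near_withinE.
  apply: filterS (H e e0) => h hP h0 /=.
  by rewrite -(ler_pM2r (_ : 0 < `|h|)) ?normr_gt0 // E.
by split; [apply/cvg_ex; exists df|apply: cvg_lim].
Qed.

Lemma differentiable_estimate (W : normedModType R) (f : V -> W) (a : V) :
  differentiable f a -> forall e : R, 0 < e ->
    \forall h \near (0 : V), `|f (h + a) - f a - 'd f a h| <= e * `|h|.
Proof.
move=> /diff_locally fa e e0.
have /eqaddoP /(_ e e0) := fa; apply: filterS => h /=.
by rewrite !fctE /= opprD addrA.
Qed.

Lemma near_translate (U : set V) (u : V) :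
  nbhs u U -> \forall h \near (0 : V), U (h + u).
Proof.
move=> /nbhs_normP [r /= r0 hr]; apply/nbhs_normP; exists r => // h.
rewrite /ball_ /= sub0r normrN => hh; apply: hr.
by rewrite /ball_ /= opprD addrCA subrr addr0 normrN.
Qed.

Lemma is_derive_diff (W : normedModType R) (f : V -> W) (a v : V) :
  differentiable f a -> is_derive a v f ('d f a v).
Proof. by move=> df; split; [exact: diff_derivable|exact: deriveE]. Qed.

Lemma is_derive_near_eq (W : normedModType R) (f g : V -> W) (a v : V) (df : W) :
  (\forall y \near a, f y = g y) -> is_derive a v f df -> is_derive a v g df.
Proof. exact: near_eq_is_derive. Qed.

Lemma is_derive_sum_pt m (h : 'I_m -> V -> R) (x v : V) (dh : 'I_m -> R) :
  (forall i, is_derive x v (h i) (dh i)) ->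
  is_derive x v (fun u => \sum_i h i u) (\sum_i dh i).
Proof.
move=> H; rewrite (_ : (fun u => _) = \sum_i h i); first exact: is_derive_sum.
by apply/funext => u; rewrite fct_sumE.
Qed.

Lemma derivable_sum_pt I (r : seq I) (h : I -> V -> R) (x v : V) :
  (forall i, derivable (h i) x v) -> derivable (fun u => \sum_(i <- r) h i u) x v.
Proof.
move=> H; elim: r => [|i r IH].
  rewrite (_ : (fun u => _) = cst 0); first exact: derivable_cst.
  by apply/funext => u; rewrite big_nil.
rewrite (_ : (fun u => _) = h i + (fun u => \sum_(j <- r) h j u)).
  exact: (derivableD (H i) IH).
by apply/funext => u; rewrite big_cons.
Qed.

Lemma derivable_prod_pt I (r : seq I) (h : I -> V -> R) (x v : V) :
  (forall i, derivable (h i) x v) -> derivable (fun u => \prod_(i <- r) h i u) x v.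
Proof.
move=> H; elim: r => [|i r IH].
  rewrite (_ : (fun u => _) = cst 1); first exact: derivable_cst.
  by apply/funext => u; rewrite big_nil.
rewrite (_ : (fun u => _) = h i * (fun u => \prod_(j <- r) h j u)).
  exact: (derivableM (H i) IH).
by apply/funext => u; rewrite big_cons.
Qed.

Lemma is_derive_mul_pt (f g : V -> R) (x v : V) (df dg : R) :
  is_derive x v f df -> is_derive x v g dg ->
  is_derive x v (fun u => f u * g u) (df * g x + f x * dg).
Proof.
move=> hf hg; have -> : df * g x + f x * dg = f x *: dg + g x *: df.
  by rewrite addrC [g x *: _]mulrC.
exact: is_deriveM.
Qed.

Lemma is_derive_mxP m n (f : V -> 'M[R]_(m, n)) (x v : V) (df : 'M[R]_(m, n)) :
  is_derive x v f df <-> forall i j, is_derive x v (fun u => f u i j) (df i j).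
Proof.
split=> [[cf <-] i j|H].
  by split; [move/derivable_mxP: cf|rewrite derive_mx // mxE].
have cf : derivable f x v by apply/derivable_mxP => i j; case: (H i j).
split=> //; rewrite derive_mx //; apply/matrixP => i j; rewrite mxE.
by case: (H i j).
Qed.

Lemma is_derive_mulmx m n p (A : V -> 'M[R]_(m, n)) (B : V -> 'M[R]_(n, p))
    (x v : V) dA dB :
  is_derive x v A dA -> is_derive x v B dB ->
  is_derive x v (fun u => A u *m B u) (dA *m B x + A x *m dB).
Proof.
move=> /is_derive_mxP hA /is_derive_mxP hB; apply/is_derive_mxP => i j.
rewrite !mxE -big_split /=.
rewrite (_ : (fun u => _) = fun u => \sum_k A u i k * B u k j).
  by apply: is_derive_sum_pt => k; exact: is_derive_mul_pt.
by apply/funext => u; rewrite mxE.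
Qed.

Lemma derivable_det n (A : V -> 'M[R]_n) (x v : V) :
  (forall i j, derivable (fun u => A u i j) x v) -> derivable (fun u => \det (A u)) x v.
Proof.
move=> hA; rewrite /determinant; apply: derivable_sum_pt => s.
rewrite (_ : (fun u => _) = cst ((-1) ^+ s) * (fun u => \prod_i A u i (s i))) //.
by apply: derivableM; [exact: derivable_cst|exact: derivable_prod_pt].
Qed.

(** Cramer's rule expresses the inverse by determinants, which are polynomial
    in the entries. *)
Lemma derivable_invmx n (A : V -> 'M[R]_n) (x v : V) :
  derivable A x v -> (\forall u \near x, A u \in unitmx) ->
  derivable (fun u => invmx (A u)) x v.
Proof.
move=> /derivable_mxP hA uA.
apply: (@near_eq_derivable _ _ _ (fun u => (\det (A u))^-1 *: \adj (A u))).
  by apply: filterS uA => u Au; rewrite /invmx Au.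
apply/derivable_mxP => i j.
rewrite (_ : (fun u => _) = (fun u => (\det (A u))^-1) * (fun u => cofactor (A u) j i)); last first.
  by apply/funext => u; rewrite !mxE.
apply: derivableM.
  apply: derivableV; last exact: derivable_det.
  by have := nbhs_singleton uA; rewrite unitmxE unitfE.
rewrite (_ : (fun u => _) = cst ((-1) ^+ (j + i)) * (fun u => \det (row' j (col' i (A u))))) //.
apply: derivableM; first exact: derivable_cst.
apply: derivable_det => k l.
rewrite (_ : (fun u => _) = (fun u => A u (lift j k) (lift i l))) //.
by apply/funext => u; rewrite !mxE.
Qed.

Lemma is_derive_mink n (f g : V -> 'rV[R]_n.+1) (x v : V) df dg :
  is_derive x v f df -> is_derive x v g dg ->
  is_derive x v (fun u => mink (f u) (g u)) (mink df (g x) + mink (f x) dg).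
Proof.
move=> /is_derive_mxP hf /is_derive_mxP hg.
rewrite /mink addrACA -big_split /= -opprD.
apply: is_deriveB; last exact: is_derive_mul_pt.
by apply: is_derive_sum_pt => k; exact: is_derive_mul_pt.
Qed.

End DirectionalCalculus.

Lemma is_derive_comp_diff (R : realType) (V W : normedModType R)
    (g : R -> V) (f : V -> W) (t : R) (dg : V) :
  is_derive t 1 g dg -> differentiable f (g t) ->
  is_derive t 1 (f \o g) ('d f (g t) dg).
Proof.
move=> [cg <-] df; have dg' : differentiable g t by exact/derivable1_diffP.
have -> : 'd f (g t) ('D_1 g t) = 'd (f \o g) t 1.
  by rewrite (diff_comp dg' df) /= deriveE.
by apply: is_derive_diff; exact: differentiable_comp.
Qed.

Lemma is_derive_along (R : realType) (V W : normedModType R)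
    (w : R -> V) (f : V -> W) (u x : V) :
  w 0 = u -> is_derive (0 : R) 1 w x -> differentiable f u ->
  is_derive (0 : R) 1 (f \o w) ('D_x f u).
Proof.
by move=> <- dw df; rewrite deriveE //; exact: is_derive_comp_diff.
Qed.

Lemma is_derive_lineP (R : realType) (V W : normedModType R) (f : V -> W)
    (x w : V) (s : R) (df : W) :
  is_derive (s *: x + w) x f df <-> is_derive s 1 (fun s : R => f (s *: x + w)) df.
Proof.
by split=> /is_derive_estimateP H; apply/is_derive_estimateP => e e0;
  apply: filterS (H e e0) => h; rewrite [h *: 1]mulr1 scalerDl addrA.
Qed.

(** * Symmetry of second derivatives *)

Section SecondDerivatives.
Variables (R : realType) (V : normedModType R).

(** The second difference of [f] over the parallelogram spanned by [t x] and
    [t y] is, by the mean value theorem in the direction [x], close to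
    [t ^ 2 D_y D_x f]. *)
Lemma second_difference (U : set V) (f g : V -> R) (u x y : V) :
  open U -> U u -> (forall w, U w -> is_derive w x f (g w)) ->
  differentiable g u -> forall e : R, 0 < e ->
  \forall t \near (0 : R), 0 < t ->
   `|f (t *: x + (t *: y + u)) - f (t *: x + u) - f (t *: y + u) + f u
      - t ^+ 2 * 'D_y g u| <= e * t ^+ 2.
Proof.
move=> oU Uu df ddf e e0.
set K := 2 * `|x| + `|y| + 1.
have K0 : 0 < K by rewrite /K ltr_wpDl // addr_ge0 // mulr_ge0.
have eK : 0 < e / K by rewrite divr_gt0.
have : \forall h \near (0 : V), U (h + u) /\
    `|g (h + u) - g u - 'd g u h| <= e / K * `|h|.
  near=> h; split; last by near: h; exact: differentiable_estimate.
  by near: h; apply: near_translate; exact: open_nbhs_nbhs.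
move=> /nbhs_normP [r /= r0 hr].
have P (t s z : R) : 0 < t -> t * K < r -> 0 <= s <= t -> z = 0 \/ z = t ->
    `|s *: x + z *: y| < r.
  move=> t0 tK /andP [s0 st] zt.
  have z0 : `|z| <= t by case: zt => ->; [rewrite normr0 ltW|rewrite gtr0_norm].
  apply: le_lt_trans tK; apply: (le_trans (ler_normD _ _)).
  rewrite !normrZ (ger0_norm s0).
  have h1 := ler_wpM2r (normr_ge0 x) st.
  have h2 := ler_wpM2r (normr_ge0 y) z0.
  have h3 := mulr_ge0 (ltW t0) (normr_ge0 x).
  by rewrite (le_trans (lerD h1 h2)) // /K; lra.
have rK : \forall t \near (0 : R), `|t| < r / K by apply: nbhs0_lt; rewrite divr_gt0.
apply: filterS rK => t rK t0.
have tK : t * K < r.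
  by rewrite -ltr_pdivlMr // -(gtr0_norm t0).
pose phi s := f (s *: x + (t *: y + u)) - f (s *: x + u).
pose dphi s := g (s *: x + (t *: y + u)) - g (s *: x + u).
have Ut (s z : R) : 0 <= s <= t -> z = 0 \/ z = t -> U (s *: x + (z *: y + u)) /\
    `|g (s *: x + (z *: y + u)) - g u - 'd g u (s *: x + z *: y)| <= e / K * `|s *: x + z *: y|.
  move=> st zt; rewrite addrA; apply: hr; rewrite /ball_ /= sub0r normrN.
  exact: (P t).
have Dline w (s : R) : U (s *: x + w) -> is_derive s 1 (fun s => f (s *: x + w)) (g (s *: x + w)).
  by move=> Us; exact: (@is_derive_lineP R V R f x w s (g (s *: x + w))).1 (df _ Us).
have [s /[!in_itv] /= s01 Es] : exists2 s, s \in `]0, t[%R & phi t - phi 0 = dphi s * (t - 0).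
  apply: MVT => // [s|].
    rewrite in_itv /= => /andP [s0 st]; have st' : 0 <= s <= t by rewrite !ltW.
    have := @Ut s 0 st' (or_introl erefl); rewrite scale0r add0r => -[U1 _].
    by apply: is_deriveB; apply: Dline => //; apply: (Ut s t st' (or_intror erefl)).1.
  apply: derivable_within_continuous => s; rewrite in_itv /= => st.
  have := @Ut s 0 st (or_introl erefl); rewrite scale0r add0r => -[U1 _].
  have h1 := Dline _ _ (Ut s t st (or_intror erefl)).1.
  by have [] := is_deriveB h1 (Dline _ _ U1).
have st : 0 <= s <= t by case/andP: s01 => ? ?; rewrite !ltW.
have [_ e1] := @Ut s t st (or_intror erefl).
have [_ e2] := @Ut s 0 st (or_introl erefl).
rewrite scale0r add0r addr0 in e2.
have -> : f (t *: x + (t *: y + u)) - f (t *: x + u) - f (t *: y + u) + f u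
     - t ^+ 2 * 'D_y g u = t * (dphi s - t * 'D_y g u).
  move: Es; rewrite subr0 /phi scale0r !add0r => Es.
  rewrite mulrBr [t * dphi s]mulrC -Es expr2; ring.
rewrite normrM (gtr0_norm t0) expr2 mulrCA ler_pM2l //.
have -> : dphi s - t * 'D_y g u =
    (g (s *: x + (t *: y + u)) - g u - 'd g u (s *: x + t *: y))
    - (g (s *: x + u) - g u - 'd g u (s *: x)).
  have -> : 'd g u (s *: x + t *: y) = 'd g u (s *: x) + t * 'D_y g u.
    by rewrite linearD deriveE //; congr (_ + _); exact: linearZ.
  by rewrite /dphi; ring.
apply: (le_trans (ler_normB _ _)).
apply: (le_trans (lerD e1 e2)); rewrite -mulrDr -mulrA ler_pM2l // ler_pdivrMl //.
apply: le_trans (_ : `|s *: x| + `|t *: y| + `|s *: x| <= _).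
  by rewrite lerD2r ler_normD.
case/andP: st => s0 st; rewrite !normrZ (ger0_norm s0) (gtr0_norm t0) /K.
by have h1 := ler_wpM2r (normr_ge0 x) st; lra.
Unshelve. all: by end_near. Qed.

(** Young's theorem: both iterated derivatives are the limit of the same
    second difference quotient. *)
Lemma derive_commute (U : set V) (f g h : V -> R) (u x y : V) :
  open U -> U u -> (forall w, U w -> is_derive w x f (g w)) ->
  (forall w, U w -> is_derive w y f (h w)) ->
  differentiable g u -> differentiable h u -> 'D_y g u = 'D_x h u.
Proof.
move=> oU Uu df df' dx dy; apply/eqP; rewrite -subr_eq0 -normr_le0.
apply/ler_addgt0Pr => e e0; rewrite add0r.
have e2 : 0 < e / 2 by rewrite divr_gt0.
have [t [t0 h1 h2]] : exists t : R, [/\ 0 < t,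
   `|f (t *: x + (t *: y + u)) - f (t *: x + u) - f (t *: y + u) + f u
      - t ^+ 2 * 'D_y g u| <= e / 2 * t ^+ 2 &
   `|f (t *: y + (t *: x + u)) - f (t *: y + u) - f (t *: x + u) + f u
      - t ^+ 2 * 'D_x h u| <= e / 2 * t ^+ 2].
  have /nbhs_normP [r1 /= r10 H1] := second_difference y oU Uu df dx e2.
  have /nbhs_normP [r2 /= r20 H2] := second_difference x oU Uu df' dy e2.
  set t := Num.min r1 r2 / 2.
  have m0 : 0 < Num.min r1 r2 by rewrite lt_min r10.
  have t0 : 0 < t by rewrite divr_gt0.
  have : `|t| < Num.min r1 r2.
    by rewrite gtr0_norm // ltr_pdivrMr // ltr_pMr // ltr1n.
  rewrite lt_min => /andP [t1 t2].
  exists t; split => //; [apply: H1|apply: H2] => //;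
    by rewrite /ball_ /= sub0r normrN.
rewrite [t *: y + (t *: x + u)]addrCA in h2.
have t2 : 0 < t ^+ 2 by rewrite exprn_gt0.
rewrite -(ler_pM2l t2) -[X in X * `|_|](gtr0_norm t2) -normrM.
have alg (F p q r A B c : R) :
  c * (A - B) = (F - p - q + r - c * B) - (F - q - p + r - c * A) by ring.
rewrite (alg (f (t *: x + (t *: y + u))) (f (t *: y + u)) (f (t *: x + u)) (f u)).
rewrite (le_trans (ler_normB _ _)) // (le_trans (lerD h2 h1)) // -mulrDl -splitr mulrC //.
Qed.

End SecondDerivatives.

Lemma derive_commute_rV (R : realType) (n m : nat) (U : set 'rV[R]_n)
    (F : 'rV[R]_n -> 'rV[R]_m.+1) (u x y : 'rV[R]_n) :
  open U -> U u -> (forall w, U w -> differentiable F w) ->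
  differentiable ('D_x F) u -> differentiable ('D_y F) u ->
  'D_y ('D_x F) u = 'D_x ('D_y F) u.
Proof.
move=> oU Uu dF dx dy; apply/rowP => j.
have DF z w : U w -> is_derive w z (fun v => F v 0 j) ('D_z F w 0 j).
  move=> Uw; have := is_derive_diff z (dF w Uw).
  by rewrite -deriveE; [move/is_derive_mxP|exact: dF].
have coord (G : 'rV[R]_n -> 'rV[R]_m.+1) : differentiable G u ->
    differentiable (fun v => G v 0 j) u.
  move=> dG; apply: (@differentiable_comp _ _ _ _ G (fun N : 'rV[R]_m.+1 => N 0 j)) => //.
  exact: differentiable_coord.
have E (G : 'rV[R]_n -> 'rV[R]_m.+1) z : differentiable G u ->
    'D_z G u 0 j = 'D_z (fun v => G v 0 j) u.
  move=> dG; have := is_derive_diff z dG; rewrite -deriveE //.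
  by move/is_derive_mxP/(_ 0 j) => [_ ->].
have C := derive_commute oU Uu (DF x) (DF y) (coord _ dx) (coord _ dy).
have Ex := E _ y dx.
have Ey := E _ x dy.
apply: (etrans Ex).
apply: (etrans C).
exact: (esym Ey).
Qed.

(** * The induced metric and the Gauss equation *)

Section InducedMetric.
Variables (R : realType) (n : nat) (X : 'rV[R]_n -> 'rV[R]_n.+1).
Implicit Types u v x y q : 'rV[R]_n.
Implicit Types Y : 'rV[R]_n.+1.

Definition diff_mx u : 'M[R]_(n, n.+1) := lin1_mx ('d X u).

Lemma diff_mxE u x : x *m diff_mx u = 'd X u x.
Proof. by rewrite /diff_mx mul_rV_lin1. Qed.

Lemma mul_mink_dual k l (A : 'M[R]_(k, n.+1)) (B : 'M[R]_(l, n.+1)) i j :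
  (A *m mink_dual B) i j = mink (row i A) (row j B).
Proof.
rewrite mink_dualE /mink_dual !mulmxA tr_row -!row_mul !mxE.
by apply: eq_bigr => m _; rewrite !mxE.
Qed.

Lemma first_formE u : first_form X u = diff_mx u *m mink_dual (diff_mx u).
Proof.
by apply/matrixP => i j; rewrite mul_mink_dual !rowE !diff_mxE mxE.
Qed.

Lemma metric_ip_first_form u x y :
  metric_ip (first_form X) u x y = mink ('d X u x) ('d X u y).
Proof.
by rewrite /metric_ip first_formE mink_dualE /mink_dual -!diff_mxE trmx_mul !mulmxA.
Qed.

(** Coordinates of the tangential part of an ambient vector: the unique
    solution of [<dX x, dX q> = <Y, dX q>] when the induced metric is
    nondegenerate. *)
Definition tangent_coord u Y : 'rV[R]_n :=
  (\row_j mink Y ('d X u (basis_vec R j))) *m invmx (first_form X u).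

Lemma row_minkE u Y q :
  ((\row_j mink Y ('d X u (basis_vec R j))) *m q^T) 0 0 = mink Y ('d X u q).
Proof.
have -> : \row_j mink Y ('d X u (basis_vec R j)) = Y *m mink_dual (diff_mx u).
  apply/rowP => j; rewrite mul_mink_dual mxE row_id rowE diff_mxE; congr (mink _ _).
by rewrite /mink_dual -mulmxA -mulmxA -trmx_mul diff_mxE mulmxA mink_dualE mulmxA.
Qed.

Lemma tangent_coordP u Y q : first_form X u \in unitmx ->
  mink ('d X u (tangent_coord u Y)) ('d X u q) = mink Y ('d X u q).
Proof.
move=> Gu; rewrite -metric_ip_first_form /metric_ip /tangent_coord mulmxKV //.
exact: row_minkE.
Qed.

End InducedMetric.

Lemma first_form_unit (R : realType) (n : nat) (X : 'rV[R]_n -> 'rV[R]_n.+1) u :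
  (forall x, x != 0 -> 0 < mink ('d X u x) ('d X u x)) ->
  first_form X u \in unitmx.
Proof.
move=> pos; rewrite -row_free_unit -kermx_eq0; apply/eqP/row_matrixP => i.
rewrite row0; set k := row i _; apply/eqP; apply: contraT => /pos.
rewrite -metric_ip_first_form /metric_ip.
have -> : k *m first_form X u = 0 by rewrite /k -row_mul mulmx_ker row0.
by rewrite mul0mx mxE ltxx.
Qed.

Section GaussEquation.
Variables (R : realType) (n : nat) (U : set 'rV[R]_n).
Variable X : 'rV[R]_n -> 'rV[R]_n.+1.
Hypotheses (oU : open U) (sX : smooth_on U X).
Hypothesis unitG : forall v, U v -> first_form X v \in unitmx.
Implicit Types u v x y w q : 'rV[R]_n.

Let nearU u : U u -> \forall v \near u, U v.
Proof. by move=> Uu; exact: open_nbhs_nbhs. Qed.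

Lemma param_diff u : U u -> differentiable X u.
Proof. exact: (sX [::]). Qed.

Lemma param_deriveE u x : U u -> 'D_x X u = 'd X u x.
Proof. by move=> Uu; rewrite deriveE //; exact: param_diff. Qed.

Lemma is_derive_param1 u x y : U u ->
  is_derive u x (fun v => 'd X v y) ('D_x ('D_y X) u).
Proof.
move=> Uu; apply: (@is_derive_near_eq _ _ _ ('D_y X)).
  by apply: filterS (nearU Uu) => v Uv; exact: param_deriveE.
by split=> //; apply: diff_derivable; exact: (sX [:: y]).
Qed.

Lemma is_derive_param2 u x y w : U u ->
  is_derive u x (fun v => 'D_y ('D_w X) v) ('D_x ('D_y ('D_w X)) u).
Proof.
by move=> Uu; split=> //; apply: diff_derivable; exact: (sX [:: y; w]).
Qed.

Lemma param_derive2C u x y : U u -> 'D_x ('D_y X) u = 'D_y ('D_x X) u.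
Proof.
move=> Uu; apply: (derive_commute_rV oU Uu) => [v||]; first exact: param_diff.
- exact: (sX [:: y]).
- exact: (sX [:: x]).
Qed.

Lemma param_derive3C u x y w : U u ->
  'D_x ('D_y ('D_w X)) u = 'D_y ('D_x ('D_w X)) u.
Proof.
move=> Uu; apply: (derive_commute_rV oU Uu) => [v Uv||]; first exact: (sX [:: w]).
- exact: (sX [:: y; w]).
- exact: (sX [:: x; w]).
Qed.

Lemma param_derive2D u x y1 y2 : U u ->
  'D_(y1 + y2) ('D_x X) u = 'D_y1 ('D_x X) u + 'D_y2 ('D_x X) u.
Proof.
move=> Uu; have d : differentiable ('D_x X) u by exact: (sX [:: x]).
by rewrite !(deriveE _ d) linearD.
Qed.

Lemma param_derive2Z u x y c : U u ->
  'D_(c *: y) ('D_x X) u = c *: 'D_y ('D_x X) u.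
Proof.
move=> Uu; have d : differentiable ('D_x X) u by exact: (sX [:: x]).
by rewrite !(deriveE _ d) linearZ.
Qed.

Let G := first_form X.

Lemma is_derive_metric u x y q A B : U u ->
  'D_x ('D_y X) u = A -> 'D_x ('D_q X) u = B ->
  is_derive u x (fun v => metric_ip G v y q)
    (mink A ('d X u q) + mink ('d X u y) B).
Proof.
move=> Uu <- <-; rewrite (_ : (fun v => _) = fun v => mink ('d X v y) ('d X v q)).
  by apply: is_derive_mink; exact: is_derive_param1.
by apply/funext => v; exact: metric_ip_first_form.
Qed.

(** In the Koszul formula for constant fields all the second derivatives
    cancel except the one along the two arguments. *)
Lemma christoffelE u x y : U u ->
  christoffel G u x y = tangent_coord X u ('D_x ('D_y X) u).
Proof.
move=> Uu; rewrite /christoffel /tangent_coord; congr (_ *m _).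
apply/rowP => m; rewrite !mxE; set e := basis_vec R m.
have [_ ->] := is_derive_metric Uu (erefl ('D_x ('D_y X) u)) (erefl ('D_x ('D_e X) u)).
have [_ ->] := is_derive_metric Uu (param_derive2C y x Uu) (erefl ('D_y ('D_e X) u)).
have [_ ->] := is_derive_metric Uu (param_derive2C e x Uu) (param_derive2C e y Uu).
have alg (a b b' c : R) : b = b' -> 2^-1 * (a + b + (a + c) - (b' + c)) = a.
  by move=> <-; field.
by apply: alg; exact: minkC.
Qed.

Lemma derivable_tangent_coord u x (Y : 'rV[R]_n -> 'rV[R]_n.+1) : U u ->
  derivable Y u x -> derivable (fun v => tangent_coord X v (Y v)) u x.
Proof.
move=> Uu /derivableP dY.
have dG : derivable G u x.
  apply/derivable_mxP => i j.
  have := is_derive_mink (is_derive_param1 x (basis_vec R i) Uu)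
    (is_derive_param1 x (basis_vec R j) Uu).
  move=> [+ _]; congr (derivable _ u x).
  by apply/funext => v; rewrite /G mxE.
have dI : derivable (fun v => invmx (G v)) u x.
  by apply: derivable_invmx => //; apply: filterS (nearU Uu) => v; exact: unitG.
have dP : derivable (fun v => \row_j mink (Y v) ('d X v (basis_vec R j))) u x.
  apply/derivable_mxP => i j.
  have := is_derive_mink dY (is_derive_param1 x (basis_vec R j) Uu).
  move=> [+ _]; congr (derivable _ u x).
  by apply/funext => v; rewrite mxE.
by have [] := is_derive_mulmx (derivableP dP) (derivableP dI).
Qed.

Lemma is_derive_tangent_field u x (V : 'rV[R]_n -> 'rV[R]_n) : U u ->
  derivable V u x ->
  is_derive u x (fun v => 'd X v (V v)) ('d X u ('D_x V u) + 'D_x ('D_(V u) X) u).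
Proof.
move=> Uu /derivableP dV.
have dA : derivable (diff_mx X) u x.
  apply/derivable_mxP => i j.
  have [+ _] := (is_derive_mxP _ _ _ _).1 (is_derive_param1 x (basis_vec R i) Uu) 0 j.
  by congr (derivable _ u x); apply/funext => v; rewrite /diff_mx mxE.
have prodE (W : 'rV[R]_n -> 'rV[R]_n) : (fun v => W v *m diff_mx X v) = fun v => 'd X v (W v).
  by apply/funext => v; rewrite diff_mxE.
have D1 := is_derive_mulmx dV (derivableP dA).
have D2 := is_derive_mulmx (is_derive_cst (V u) u x) (derivableP dA).
have [_ E] := is_derive_param1 x (V u) Uu.
rewrite mul0mx add0r in D2; case: D2 => _; rewrite prodE => E2.
have E3 : V u *m 'D_x (diff_mx X) u = 'D_x ('D_(V u) X) u.
  by apply: etrans E; apply: esym; exact: E2.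
by rewrite prodE diff_mxE E3 in D1.
Qed.

(** The metric is parallel: differentiating [<dX V, dX q>] shows that the
    ambient image of the covariant derivative is the tangential part of the
    flat derivative of [dX V]. *)
Lemma levi_civitaP u x (V : 'rV[R]_n -> 'rV[R]_n) q dF : U u ->
  derivable V u x ->
  is_derive u x (fun v => mink ('d X v (V v)) ('d X v q)) dF ->
  mink ('d X u (levi_civita G x V u)) ('d X u q)
    = dF - mink ('d X u (V u)) ('D_x ('D_q X) u).
Proof.
move=> Uu dV [_ <-].
have [_ E] := is_derive_mink (is_derive_tangent_field Uu dV) (is_derive_param1 x q Uu).
apply: etrans (congr1 (fun c => c - mink ('d X u (V u)) ('D_x ('D_q X) u)) (esym E)).
rewrite addrK /levi_civita linearD minkDl christoffelE // tangent_coordP ?unitG //.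
by rewrite minkDl.
Qed.

Variables (u : 'rV[R]_n) (N : 'rV[R]_n.+1).
Hypotheses (Uu : U u) (N_unit : mink N N = -1).
Hypothesis N_orth : forall q, mink N ('d X u q) = 0.
Hypothesis pos_u : forall x, x != 0 -> 0 < mink ('d X u x) ('d X u x).
Hypothesis tangentU : forall Y, mink N Y = 0 -> exists x, 'd X u x = Y.

Lemma tangent_eq x Y : (forall q, mink ('d X u x) ('d X u q) = mink Y ('d X u q)) ->
  mink N Y = 0 -> 'd X u x = Y.
Proof.
move=> H /tangentU [y yY]; rewrite -yY; congr ('d X u _).
apply/eqP; rewrite -subr_eq0; apply: contraT => /pos_u.
have := H (x - y); rewrite -yY => H'.
by rewrite {1}linearB /= minkDl minkNl H' subrr ltxx.
Qed.

Lemma tangent_coordE Y : 'd X u (tangent_coord X u Y) = Y + mink N Y *: N.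
Proof.
apply: tangent_eq => [q|].
  by rewrite tangent_coordP ?unitG // minkDl minkZl N_orth mulr0 addr0.
by rewrite minkDr minkZr N_unit mulrN1 subrr.
Qed.

Definition second_form x y : R := mink N ('D_x ('D_y X) u).

Lemma second_formC x y : second_form x y = second_form y x.
Proof. exact: (congr1 (mink N) (param_derive2C x y Uu)). Qed.

Lemma second_formD x y1 y2 : second_form (y1 + y2) x = second_form y1 x + second_form y2 x.
Proof. by rewrite /second_form param_derive2D // minkDr. Qed.

Lemma second_formZ x y c : second_form (c *: y) x = c * second_form y x.
Proof. by rewrite /second_form param_derive2Z // minkZr. Qed.

Lemma levi_civita2P x y w q :
  mink ('d X u (levi_civita G x (levi_civita G y (fun=> w)) u)) ('d X u q)
   = mink ('D_x ('D_y ('D_w X)) u) ('d X u q) - second_form y w * second_form x q.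
Proof.
have E v : U v -> levi_civita G y (fun=> w) v = tangent_coord X v ('D_y ('D_w X) v).
  move=> Uv; rewrite /levi_civita christoffelE //.
  by rewrite (_ : (fun=> w) = cst w) // derive_cst add0r.
have d2 := is_derive_param2 x y w Uu.
have dV : derivable (levi_civita G y (fun=> w)) u x.
  apply: near_eq_derivable (derivable_tangent_coord Uu (_ : derivable _ u x)).
    by apply: filterS (nearU Uu) => v Uv; rewrite E.
  by case: d2.
have dF : is_derive u x (fun v => mink ('d X v (levi_civita G y (fun=> w) v)) ('d X v q))
   (mink ('D_x ('D_y ('D_w X)) u) ('d X u q) + mink ('D_y ('D_w X) u) ('D_x ('D_q X) u)).
  apply: is_derive_near_eq (is_derive_mink d2 (is_derive_param1 x q Uu)).
  by apply: filterS (nearU Uu) => v Uv; rewrite E // tangent_coordP //; exact: unitG.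
rewrite (levi_civitaP Uu dV dF) E // tangent_coordE minkDl minkZl.
have alg (a b c : R) : a + b - (b + c) = a - c by ring.
exact: alg.
Qed.

(** The third derivatives of the parametrization cancel by symmetry, and the
    normal parts of the second derivatives remain, with the sign of the
    time-like normal. *)
Lemma gauss_equation x y w q :
  riemann G u x y w q
    = second_form x w * second_form y q - second_form y w * second_form x q.
Proof.
rewrite /riemann /riemann_op metric_ip_first_form linearB minkDl minkNl.
apply: (etrans (congr2 (fun a b => a - b) (levi_civita2P x y w q) (levi_civita2P y x w q))).
have alg (a a' b c : R) : a = a' -> a - b - (a' - c) = c - b by move=> ->; ring.
exact: (alg _ _ _ _ (congr1 (fun Z => mink Z ('d X u q)) (param_derive3C x y w Uu))).
Qed.

End GaussEquation.

(** * Curves in a hypersurface *)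

Section CurveLifting.
Variable R : realType.

Lemma mulmx_lipschitz m n (P : 'M[R]_(m, n)) :
  exists2 C : R, 0 < C & forall Y : 'rV[R]_m, `|Y *m P| <= C * `|Y|.
Proof.
set S := \sum_k \sum_j `|P k j|.
have S0 : 0 <= S by do 2! (apply: sumr_ge0 => ? _).
exists (1 + S) => [|Y]; first by rewrite ltr_pwDl.
have Yk i k : `|Y i k| <= `|Y|.
  by rewrite [leRHS]/Num.norm /= mx_normrE; exact: (le_bigmax _ _ (i, k)).
rewrite [leLHS]/Num.norm /= mx_normrE; apply/bigmax_leP; split => [|[i j] _ /=].
  by rewrite mulr_ge0 // addr_ge0.
rewrite mxE (le_trans (ler_norm_sum _ _ _)) //.
rewrite (@le_trans _ _ (S * `|Y|)) //; last by rewrite ler_wpM2r // lerDr.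
rewrite /S mulr_suml; apply: ler_sum => k _; rewrite normrM mulrC.
apply: ler_pM => //.
rewrite (bigD1 j) //= lerDl; exact: sumr_ge0.
Qed.

Lemma diff_mx_free n (X : 'rV[R]_n -> 'rV[R]_n.+1) u :
  injective ('d X u) -> row_free (diff_mx X u).
Proof.
move=> inj; rewrite -kermx_eq0; apply/eqP/row_matrixP => i; rewrite row0.
apply: inj; rewrite -diff_mxE -row_mul mulmx_ker row0.
by rewrite linear0.
Qed.

(** A parametrization is a homeomorphism onto an open part of [M], so a curve
    in [M] lifts to the coordinates; its differential is bounded below, which
    makes the lift differentiable where the curve is. *)
Lemma lift_curve n (M : set 'rV[R]_n.+1) U X u (g : R -> 'rV[R]_n.+1) v :
  local_param M U X -> U u -> g 0 = X u ->
  (\forall t \near 0, M (g t)) -> is_derive (0 : R) 1 g v ->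
  exists (w : R -> 'rV[R]_n) (x : 'rV[R]_n),
    [/\ w 0 = u, \forall t \near 0, U (w t) /\ X (w t) = g t,
        is_derive (0 : R) 1 w x & 'd X u x = v].
Proof.
move=> [oU sX inj injU hom] Uu g0 Mg dg.
have dX : differentiable X u by exact: (sX [::]).
have gc : {for 0, continuous g}.
  by apply/differentiable_continuous/derivable1_diffP; case: dg.
have nearV (V : set 'rV[R]_n) : open V -> V `<=` U -> V u ->
    \forall t \near (0 : R), exists2 y, V y & X y = g t.
  move=> oV VU Vu; have [W oW XV] := hom V oV VU.
  have Wg : \forall t \near (0 : R), W (g t).
    apply: gc; rewrite g0; apply: open_nbhs_nbhs; split => //.
    have XuV : (X @` V) (X u) by exists u.
    by move: XuV; rewrite XV => -[].
  apply: filterS2 Mg Wg => t Mt Wt.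
  have : (M `&` W) (g t) by split.
  by rewrite -XV => -[y Vy yt]; exists y.
(* Away from 0 the curve may leave the chart, where the lift is arbitrary. *)
have ex t : exists y, (exists2 y', U y' & X y' = g t) -> U y /\ X y = g t.
  have [[y Uy yt]|no] := pselect (exists2 y', U y' & X y' = g t); first by exists y.
  by exists u => /no.
have [w wP] := choice ex.
have wU : \forall t \near (0 : R), U (w t) /\ X (w t) = g t.
  by apply: filterS (nearV U oU (@subset_refl _ _) Uu) => t /wP.
have w0 : w 0 = u.
  have [Uw0 Xw0] := nbhs_singleton wU.
  by apply: injU; rewrite ?inE // Xw0 g0.
have wc : w @ 0 --> u.
  move=> B; rewrite nbhsE => -[V [oV Vu] VB].
  have oVU : open (V `&` U) by exact: openI.
  apply: filterS2 (nearV _ oVU (@subIsetr _ _ _) (conj Vu Uu)) wU.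
  move=> t [y [Vy Uy] Xy] [Uw Xw]; apply: VB.
  by rewrite (injU (w t) y) ?inE // Xw Xy.
set P := pinvmx (diff_mx X u).
have PK h : 'd X u h *m P = h by rewrite -diff_mxE mulmxKp // diff_mx_free //; exact: inj.
have [C C0 CP] := mulmx_lipschitz P.
have low h : `|h| <= C * `|'d X u h| by rewrite -{1}(PK h).
exists w, (v *m P).
have K0 : 0 < 2 * C * (`|v| + 1) by rewrite !mulr_gt0 // ltr_wpDl.
set K := 2 * C * (`|v| + 1) in K0.
have Dw : is_derive (0 : R) 1 w (v *m P).
  apply/is_derive_estimateP => e e0.
  (* e1 is the error allowed in the expansion of X at u and e2 the one allowed
     in that of g: with e1 C <= 1/2 the lift is K-Lipschitz at 0, and then both
     errors add up to at most e. *)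
  set e1 := Num.min ((2 * C)^-1) (e / (C * (K + 1))).
  have e10 : 0 < e1.
    by rewrite lt_min invr_gt0 mulr_gt0 //= divr_gt0 // mulr_gt0 // addr_gt0.
  set e2 := Num.min 1 (e / (C * (K + 1))).
  have e20 : 0 < e2.
    by rewrite lt_min ltr01 /= divr_gt0 // mulr_gt0 // addr_gt0.
  have Xe : \forall t \near (0 : R), `|X (w t) - X u - 'd X u (w t - u)| <= e1 * `|w t - u|.
    have := differentiable_estimate dX e10 => H.
    have wt0 : (fun t => w t - u) @ (0 : R) --> (0 : 'rV[R]_n).
      by rewrite -(subrr u); apply: cvgB => //; exact: cvg_cst.
    have H' : \forall t \near (0 : R),
        `|X (w t - u + u) - X u - 'd X u (w t - u)| <= e1 * `|w t - u| := wt0 _ H.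
    by apply: filterS H' => t; rewrite subrK.
  have ge := (is_derive_estimateP g 0 1 v).1 dg e2 e20.
  apply: filterS3 Xe ge wU => t Xt gt [Ut XgE].
  rewrite [t *: 1]mulr1 addr0 in gt *.
  rewrite XgE -g0 in Xt; rewrite w0.
  set d := w t - u in Xt *.
  set D := g t - g 0 in Xt gt.
  have e1C : e1 * (2 * C) <= 1.
    by rewrite -ler_pdivlMr ?mulr_gt0 // div1r /e1 ge_min lexx.
  have e21 : e2 <= 1 by rewrite /e2 ge_min lexx.
  have e1K : e1 * (C * (K + 1)) <= e.
    by rewrite -ler_pdivlMr ?mulr_gt0 ?addr_gt0 // /e1 ge_min lexx orbT.
  have e2K : e2 * (C * (K + 1)) <= e.
    by rewrite -ler_pdivlMr ?mulr_gt0 ?addr_gt0 // /e2 ge_min lexx orbT.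
  have Dn : `|D| <= (`|v| + 1) * `|t|.
    have -> : D = (D - t *: v) + t *: v by rewrite subrK.
    rewrite (le_trans (ler_normD _ _)) // normrZ mulrDl addrC mulrC lerD2l.
    by rewrite (le_trans gt) // ler_wpM2r.
  have dn : `|d| <= K * `|t|.
    have h1 : `|'d X u d| <= `|D| + e1 * `|d|.
      have -> : 'd X u d = D - (D - 'd X u d) by rewrite opprB addrC subrK.
      by rewrite (le_trans (ler_normB _ _)) // lerD2l.
    have h2 : C * (e1 * `|d|) <= `|d| / 2.
      rewrite ler_pdivlMr // (_ : _ * 2 = (e1 * (2 * C)) * `|d|); last by ring.
      by rewrite -[leRHS]mul1r ler_wpM2r.
    have h3 : `|d| <= C * ((`|v| + 1) * `|t|) + `|d| / 2.
      rewrite (le_trans (low d)) // (le_trans (ler_wpM2l (ltW C0) h1)) // mulrDr lerD //.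
      by rewrite ler_wpM2l // ltW.
    rewrite /K; lra.
  have -> : d - t *: (v *m P) = ('d X u d - t *: v) *m P by rewrite mulmxBl PK -scalemxAl.
  rewrite (le_trans (CP _)) //.
  have h4 : `|'d X u d - t *: v| <= e2 * `|t| + e1 * (K * `|t|).
    have -> : 'd X u d - t *: v = (D - t *: v) - (D - 'd X u d).
      by rewrite [RHS]addrC opprB addrA subrK.
    rewrite (le_trans (ler_normB _ _)) // lerD // (le_trans Xt) //.
    by rewrite ler_wpM2l // ltW.
  rewrite (le_trans (ler_wpM2l (ltW C0) h4)) //.
  have t0 := normr_ge0 t.
  have h5 := ler_wpM2r t0 e2K.
  have h6 := ler_wpM2r t0 e1K.
  have h : (e2 * (C * (K + 1)) * `|t|) + K * (e1 * (C * (K + 1)) * `|t|) <= (K + 1) * (e * `|t|).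
    by rewrite mulrDl mul1r addrC lerD // ler_wpM2l // ltW.
  have K1 : 0 < K + 1 by rewrite addr_gt0.
  rewrite -(ler_pM2l K1); apply: le_trans h; rewrite le_eqVlt; apply/orP; left; apply/eqP.
  by ring.
split => //.
have dXw : differentiable X (w 0) by rewrite w0.
have [_ E1] := is_derive_comp_diff Dw dXw.
have [_ E2] := dg.
rewrite w0 in E1.
apply: (etrans (esym E1)); apply: (etrans _ E2); apply: near_eq_derive.
by apply: filterS wU => t [].
Qed.

End CurveLifting.

Lemma mink_sqrD (R : realType) (n : nat) (x y : 'rV[R]_n.+1) (a : R) :
  mink (x + a *: y) (x + a *: y) = mink x x + 2 * a * mink x y + a ^+ 2 * mink y y.
Proof.
rewrite minkDl !minkDr !minkZl !minkZr (minkC y x).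
by ring.
Qed.

(** Spheres of codimension two have curves in all directions orthogonal to
    [Z - c] and [w]: reflecting [Z - c] in the hyperplanes orthogonal to the
    vectors [v + k t q], with [q] orthogonal to [w], preserves the sphere. *)
Lemma codim2_sphere_curve (R : realType) (n : nat) (c w Z v : 'rV[R]_n.+1) (r d : R) :
  0 < r -> (spacelike_hypersphere c r `&` hyperplane w d) Z ->
  \rank (col_mx (Z - c) w) = 2%N ->
  mink (Z - c) v = 0 -> mink w v = 0 ->
  exists g : R -> 'rV[R]_n.+1, [/\ g 0 = Z,
    forall t, (spacelike_hypersphere c r `&` hyperplane w d) (g t) &
    is_derive (0 : R) 1 g v].
Proof.
move=> r0 [ZS Zw] rk; rewrite /spacelike_hypersphere /hyperplane /= in ZS Zw.
set y := Z - c in ZS rk * => yv wv.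
have [->|v0] := eqVneq v 0.
  by exists (cst Z); split => //; exact: is_derive_cst.
have yy : mink y y < 0 by rewrite ZS oppr_lt0 exprn_gt0.
have vv : 0 < mink v v by exact: spacelike_of_orth_timelike yv v0.
set q := mink w w *: y - mink y w *: w.
have qw : mink q w = 0.
  by rewrite /q minkDl minkNl !minkZl [mink w w * _]mulrC subrr.
set p := mink y q.
have p0 : p != 0.
  rewrite lt_eqF // /p /q minkDr minkNr !minkZr -expr2.
  exact: lorentz_gram_lt0.
(* With this k the reflection moves Z with velocity v, and not just with a
   multiple of it. *)
set k := - mink v v / (2 * p).
pose m (t : R) : 'rV[R]_n.+1 := (k * t) *: q + v.
pose f (t : R) : R := t * (mink v v / mink (m t) (m t)).
have m0 : m 0 = v by rewrite /m mulr0 scale0r add0r.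
exists (fun t => Z + f t *: m t); split.
- by rewrite /f mul0r scale0r addr0.
- move=> t; split; rewrite /spacelike_hypersphere /hyperplane /=.
    have -> : Z + f t *: m t - c = y + f t *: m t by rewrite addrAC.
    have ym : mink y (m t) = - (mink v v * t) / 2.
      by rewrite /m minkDr yv addr0 minkZr -/p /k; field; exact: p0.
    rewrite mink_sqrD ZS.
    have [mm0|mm0] := eqVneq (mink (m t) (m t)) 0.
      have -> : f t = 0 by rewrite /f mm0 invr0 !mulr0.
      by rewrite expr0n mulr0 !mul0r !addr0.
    by rewrite ym /f; field.
  rewrite minkDl minkZl /m minkDl minkZl qw (minkC v) wv.
  by rewrite mulr0 addr0 mulr0 addr0.
have dm : is_derive (0 : R) 1 m (k *: q).
  have -> : m = (fun t => t *: (k *: q) + v).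
    by apply/funext => t; rewrite /m scalerA mulrC.
  by apply: (@is_derive_lineP _ _ _ id (k *: q) v 0 (k *: q)).1; exact: is_derive_id.
have [c1 _] := is_derive_mink dm dm.
have vm : mink (m 0) (m 0) != 0 by rewrite m0 gt_eqF.
have c3 := @derivableV _ _ (fun t => mink (m t) (m t)) 0 1 vm c1.
have D1 := is_derive_mul_pt (is_derive_cst (mink v v) (0 : R) (1 : R)) (derivableP c3).
have D2 := is_derive_mul_pt (is_derive_id (0 : R) (1 : R)) D1.
have df : is_derive (0 : R) 1 f 1.
  move: D2; rewrite /cst mul0r addr0 mul1r m0 divff ?gt_eqF //.
apply/is_derive_mxP => i j.
have dmj := (is_derive_mxP _ _ _ _).1 dm i j.
have := is_derive_mul_pt df dmj.
rewrite /= m0 [f 0]mul0r mul0r addr0 mul1r => D.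
have := is_deriveD (is_derive_cst (Z i j) (0 : R) (1 : R)) D; rewrite add0r.
rewrite (_ : (fun u => (Z + f u *: m u) i j) = cst (Z i j) + (fun u => f u * m u i j)) //.
by apply/funext => t; rewrite mxE [X in _ + X]mxE.
Qed.

(** * Parametrizations *)

Section LocalParametrization.
Variables (R : realType) (n : nat) (M : set 'rV[R]_n.+1).

Lemma local_param_mem U X u : local_param M U X -> U u -> M (X u).
Proof.
move=> [oU _ _ _ hom] Uu; have [W _ XU] := hom U oU (@subset_refl _ _).
have : (X @` U) (X u) by exists u.
by rewrite XU => -[].
Qed.

Lemma local_param_tangent U X u x :
  local_param M U X -> U u -> tangent M (X u) ('d X u x).
Proof. by move=> hX Uu; exists U, X, u, x. Qed.

Lemma local_param_pos U X u x : spacelike_hypersurface M ->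
  local_param M U X -> U u -> x != 0 -> 0 < mink ('d X u x) ('d X u x).
Proof.
move=> [_ pos] hX Uu x0; apply: (pos (X u)).
- exact: local_param_mem hX Uu.
- exact: (local_param_tangent x hX Uu).
- case: hX => _ _ inj _ _; apply: contra x0 => /eqP dx; apply/eqP.
  by apply: (inj u Uu); rewrite dx linear0.
Qed.

Lemma local_param_unit U X u : spacelike_hypersurface M ->
  local_param M U X -> U u -> first_form X u \in unitmx.
Proof.
by move=> hM hX Uu; apply: first_form_unit => x; exact: (local_param_pos hM hX Uu).
Qed.

(** The derivative of an ambient field along a tangent vector is computed by
    any parametrization, since curves can be transported between charts. *)
Lemma derive_field_param U1 X1 u1 x1 U2 X2 u2 x2 (F : 'rV[R]_n.+1 -> 'rV[R]_n.+1) :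
  smooth_field M F ->
  local_param M U1 X1 -> U1 u1 -> local_param M U2 X2 -> U2 u2 ->
  X1 u1 = X2 u2 -> 'd X1 u1 x1 = 'd X2 u2 x2 ->
  'D_x1 (F \o X1) u1 = 'D_x2 (F \o X2) u2.
Proof.
move=> sF h1 Uu1 h2 Uu2 E dE.
have d1 : differentiable (F \o X1) u1 by exact: (sF _ _ h1 [::]).
have d2 : differentiable (F \o X2) u2 by exact: (sF _ _ h2 [::]).
have dX2 : differentiable X2 u2 by case: h2 => _ s2 _ _ _; exact: (s2 [::]).
pose l (t : R) := t *: x2 + u2.
have l0 : l 0 = u2 by rewrite /l scale0r add0r.
have dl : is_derive (0 : R) 1 l x2.
  by apply: (@is_derive_lineP _ _ _ id x2 u2 0 x2).1; exact: is_derive_id.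
have lU : \forall t \near (0 : R), U2 (l t).
  have lc : {for 0, continuous l}.
    by apply/differentiable_continuous/derivable1_diffP; case: dl.
  apply: lc; rewrite l0; apply: open_nbhs_nbhs; split => //.
  by case: h2.
have g0 : (X2 \o l) 0 = X1 u1 by rewrite /= l0.
have Mg : \forall t \near (0 : R), M ((X2 \o l) t).
  by apply: filterS lU => t; exact: local_param_mem.
have dX2l : differentiable X2 (l 0) by rewrite l0.
have dg := is_derive_comp_diff dl dX2l.
rewrite l0 -dE in dg.
have [w [x [w0 wU dw dx]]] := lift_curve h1 Uu1 g0 Mg dg.
have xE : x = x1 by case: h1 => _ _ inj _ _; exact: (inj u1 Uu1).
have d1' : differentiable (F \o X1) (w 0) by rewrite w0.
have d2' : differentiable (F \o X2) (l 0) by rewrite l0.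
have [_ D1] := is_derive_comp_diff dw d1'.
have [_ D2] := is_derive_comp_diff dl d2'.
rewrite w0 xE in D1; rewrite l0 in D2.
apply: (etrans (deriveE x1 d1)); apply: (etrans (esym D1)).
apply: (etrans _ (esym (deriveE x2 d2))); apply: (etrans _ D2).
apply: near_eq_derive; apply: filterS wU => t [_ Xw] /=.
by rewrite Xw.
Qed.

End LocalParametrization.

(** * Canal hypersurfaces *)

Section CanalPoint.
Variables (R : realType) (n : nat) (M : set 'rV[R]_n.+1) (J : set R).
Variables (S : R -> set 'rV[R]_n.+1) (z : R -> 'rV[R]_n.+1) (rad : R -> R).
Hypotheses (canalM : canal_hypersurface M J S z rad) (hypM : hyperbolic_type J z).

Variable s : R.
Hypothesis Js : J s.

Let t := derive1 z s.
Let dr := derive1 rad s.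

Let r_gt0 : 0 < rad s. Proof. exact: (canal_radius_gt0 canalM Js). Qed.
Let r_neq0 : rad s != 0. Proof. by rewrite gt_eqF. Qed.
Let tt_gt0 : 0 < mink t t. Proof. exact: hypM. Qed.

(** The square of [t - R' N]: it does not vary along the generator because
    [<t, N> = - R'] there. *)
Definition direction_norm2 : R := mink t t + dr ^+ 2.

Lemma direction_norm2_gt0 : 0 < direction_norm2.
Proof. by rewrite /direction_norm2 ltr_pwDl // sqr_ge0. Qed.

Let q := direction_norm2.
Let sq_gt0 : 0 < Num.sqrt q. Proof. by rewrite sqrtr_gt0 direction_norm2_gt0. Qed.

Lemma canal_directionE Z : S s Z ->
  canal_direction z rad s Z = (Num.sqrt q)^-1 *: (t + (dr / rad s) *: (Z - z s)).
Proof.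
move=> SZ; rewrite /canal_direction /canal_unit_normal -/t -/dr scalerN opprK scalerA.
congr ((Num.sqrt _)^-1 *: _); rewrite mink_sqrD (minkC t).
rewrite (canal_radius canalM Js SZ) (canal_envelope canalM Js SZ) -/t -/dr.
by rewrite /q /direction_norm2; field.
Qed.

Lemma canal_direction_unit Z : S s Z ->
  mink (canal_direction z rad s Z) (canal_direction z rad s Z) = 1.
Proof.
move=> SZ; rewrite canal_directionE // minkZl minkZr mink_sqrD (minkC t).
rewrite (canal_radius canalM Js SZ) (canal_envelope canalM Js SZ) -/t -/dr.
rewrite mulrA -invfM -expr2 sqr_sqrtr ?(ltW direction_norm2_gt0) //.
rewrite (_ : _ + _ = q) ?mulVf ?gt_eqF ?direction_norm2_gt0 //.
by rewrite /q /direction_norm2; field.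
Qed.

Lemma canal_direction_center Z : S s Z ->
  mink (Z - z s) (canal_direction z rad s Z) = 0.
Proof.
move=> SZ; rewrite canal_directionE // minkZr minkDr minkZr.
rewrite (canal_radius canalM Js SZ) (canal_envelope canalM Js SZ) -/dr.
rewrite (_ : _ + _ = 0) ?mulr0 //.
by field.
Qed.

Variable Z : 'rV[R]_n.+1.
Hypothesis SZ : S s Z.

Let y := Z - z s.
Let N := canal_unit_normal z rad s Z.

Let yyE : mink y y = - rad s ^+ 2. Proof. exact: (canal_radius canalM Js SZ). Qed.
Let ytE : mink y t = rad s * dr. Proof. exact: (canal_envelope canalM Js SZ). Qed.

Lemma center_timelike : mink y y < 0.
Proof. by rewrite yyE oppr_lt0 exprn_gt0. Qed.

Lemma canal_normalE v : mink N v = - ((rad s)^-1 * mink y v).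
Proof. by rewrite /N /canal_unit_normal minkNl minkZl. Qed.

Lemma canal_normal_unit : mink N N = -1.
Proof.
rewrite canal_normalE minkC canal_normalE yyE.
by field.
Qed.

Lemma canal_normal_orth v : mink N v = 0 <-> mink y v = 0.
Proof.
rewrite canal_normalE; split => [/eqP|->]; last by rewrite mulr0 oppr0.
by rewrite oppr_eq0 mulf_eq0 invr_eq0 (negPf r_neq0) /= => /eqP.
Qed.

(** The radius and envelope conditions hold along the generator, so they can
    be differentiated in its tangent directions. *)
Lemma generator_tangent_orth (g : R -> 'rV[R]_n.+1) v :
  g 0 = Z -> (forall a, S s (g a)) -> is_derive (0 : R) 1 g v ->
  mink y v = 0 /\ mink t v = 0.
Proof.
move=> g0 Sg dg.
have dgz : is_derive (0 : R) 1 (fun a => g a - z s) v.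
  by have := is_deriveB dg (is_derive_cst (z s) (0 : R) (1 : R)); rewrite subr0.
have [_ E1] := is_derive_mink dgz dgz.
have [_ E2] := is_derive_mink dgz (is_derive_cst t (0 : R) (1 : R)).
have E1' : (fun a => mink (g a - z s) (g a - z s)) = cst (- rad s ^+ 2).
  by apply/funext => a; exact: (canal_radius canalM Js (Sg a)).
have E2' : (fun a => mink (g a - z s) (cst t a)) = cst (rad s * dr).
  by apply/funext => a; exact: (canal_envelope canalM Js (Sg a)).
rewrite E1' derive_cst g0 -/y in E1; rewrite E2' derive_cst mink0r addr0 in E2.
split; last by rewrite minkC.
by move: E1; rewrite (minkC v); lra.
Qed.

(** The tangent space of the generator is the whole orthogonal complement of
    the plane spanned by [Z - z] and [z'], by a comparison of dimensions. *)
Lemma generator_curve v : mink y v = 0 -> mink t v = 0 ->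
  exists g : R -> 'rV[R]_n.+1,
    [/\ g 0 = Z, forall a, S s (g a) & is_derive (0 : R) 1 g v].
Proof.
move=> yv tv.
have [c [r [w [d [r0 w0 SE _ rk]]]]] := canal_sphere canalM Js.
have rkZ := rk _ SZ.
have curve v' : (v' <= mink_orth (col_mx (Z - c) w))%MS ->
    exists g : R -> 'rV[R]_n.+1,
    [/\ g 0 = Z, forall a, S s (g a) & is_derive (0 : R) 1 g v'].
  move=> /mink_orth2P [h1 h2]; rewrite minkC in h1; rewrite minkC in h2.
  have SZ' : (spacelike_hypersphere c r `&` hyperplane w d) Z by rewrite -SE.
  by rewrite SE; exact: codim2_sphere_curve r0 SZ' rkZ h1 h2.
apply: (curve v).
have rk2 := rank_timelike_spacelike center_timelike tt_gt0.
apply: submx_trans (_ : (mink_orth (col_mx y t) <= _)%MS).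
  by apply/mink_orth2P; rewrite !(minkC v).
apply: mink_orth_full; last first.
  by rewrite rk2 rank_mink_orth rkZ addnC -leq_subLR.
apply/row_subP => i.
have [g [g0 Sg dg]] := curve _ (row_sub i (mink_orth (col_mx (Z - c) w))).
have [h1 h2] := generator_tangent_orth g0 Sg dg.
by apply/mink_orth2P; rewrite !(minkC (row i _)).
Qed.

Section Chart.
Variables (U : set 'rV[R]_n) (X : 'rV[R]_n -> 'rV[R]_n.+1) (u : 'rV[R]_n).
Hypotheses (hX : local_param M U X) (Uu : U u) (XuE : X u = Z).

Let hM : spacelike_hypersurface M := canal_spacelike canalM.
Let injX : injective ('d X u).
Proof. by case: hX => _ _ inj _ _; exact: inj. Qed.
Let oU : open U. Proof. by case: hX. Qed.
Let sX : smooth_on U X. Proof. by case: hX. Qed.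
Let dX : differentiable X u. Proof. exact: (sX [::] Uu). Qed.
Let unitG v : U v -> first_form X v \in unitmx.
Proof. exact: (local_param_unit hM hX). Qed.
Let pos_u x : x != 0 -> 0 < mink ('d X u x) ('d X u x).
Proof. exact: (local_param_pos hM hX Uu). Qed.

Lemma chart_center_orth x : mink y ('d X u x) = 0.
Proof.
have hT : tangent M Z ('d X u x) by exists U, X, u, x.
exact: (canal_normal canalM Js SZ hT).
Qed.

Lemma chart_normal_orth x : mink N ('d X u x) = 0.
Proof. by apply/canal_normal_orth; exact: chart_center_orth. Qed.

Lemma chart_tangent Y : mink N Y = 0 -> exists x, 'd X u x = Y.
Proof.
move=> /canal_normal_orth yY.
have : (mink_orth y <= diff_mx X u)%MS.
  apply: mink_orth_full.
    apply/row_subP => i; apply/mink_orth1P.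
    by rewrite rowE diff_mxE minkC chart_center_orth.
  have := diff_mx_free injX; rewrite /row_free => /eqP ->.
  rewrite rank_rV (_ : y != 0) ?addn1 //.
  by apply: contraTneq center_timelike => ->; rewrite mink0l ltxx.
move=> yT; have Yy : (Y <= mink_orth y)%MS by apply/mink_orth1P; rewrite minkC.
by have /submxP [x ->] := submx_trans Yy yT; exists x; rewrite diff_mxE.
Qed.

Lemma generator_lift x : mink t ('d X u x) = 0 ->
  exists w : R -> 'rV[R]_n,
    [/\ w 0 = u, \forall a \near (0 : R), U (w a) /\ S s (X (w a))
      & is_derive (0 : R) 1 w x].
Proof.
move=> tx; have [g [g0 Sg dg]] := generator_curve (chart_center_orth x) tx.
have Mg : \forall a \near (0 : R), M (g a).
  near=> a; rewrite (canal_generators canalM); exists s => //.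
rewrite -XuE in g0.
have [w [x' [w0 wU dw dx']]] := lift_curve hX Uu g0 Mg dg.
have E : x' = x by exact: injX.
exists w; split => //; last by rewrite -E.
by apply: filterS wU => a [Ua ->].
Unshelve. all: by end_near. Qed.

(** Along the generator all the normals point to the same center [z]:
    differentiating [<D_p X, X - z> = 0] in its tangent directions shows that
    these are principal with the curvature [1 / R]. *)
Lemma second_form_generator x p : mink t ('d X u x) = 0 ->
  second_form X u N x p = (rad s)^-1 * mink ('d X u x) ('d X u p).
Proof.
move=> tx; have [w [w0 wU dw]] := generator_lift tx.
have D2 := is_derive_along w0 dw (sX [:: p] Uu).
have D1 := is_deriveB (is_derive_along w0 dw dX) (is_derive_cst (z s) (0 : R) (1 : R)).
have [_ D] := is_derive_mink D2 D1.
have D0 : 'D_1 (fun a => mink (('D_p X \o w) a) ((X \o w - cst (z s)) a)) (0 : R) = 0.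
  apply: etrans (derive_cst (0 : R) (0 : R) (1 : R)); apply: near_eq_derive.
  apply: filterS wU => a [Ua Sa].
  rewrite /= /cst; have -> : 'D_p X (w a) = 'd X (w a) p.
    by apply: deriveE; exact: (sX [::] Ua).
  have hT := local_param_tangent p hX Ua.
  rewrite minkC; exact: (canal_normal canalM Js Sa hT).
have D3 := etrans (esym D) D0.
have e1 : (X \o w - cst (z s)) 0 = y by rewrite /y -XuE -w0.
have e2 : ('D_p X \o w) 0 = 'd X u p by rewrite /= w0; exact: deriveE.
have e3 : 'D_x X u - 0 = 'd X u x by rewrite subr0; exact: deriveE.
have D4 := etrans (congr2 +%R (congr1 (mink ('D_x ('D_p X) u)) (esym e1))
  (congr2 (@mink R n) (esym e2) (esym e3))) D3.
apply: (etrans (canal_normalE _)).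
rewrite -mulrN; congr (_ * _).
apply/eqP; rewrite eqr_oppLR -addr_eq0; apply/eqP.
by apply: etrans D4; congr (_ + _); exact: minkC.
Qed.

Section Field.
Variable xi : 'rV[R]_n.+1 -> 'rV[R]_n.+1.
Hypothesis xiP : canal_field M J S z rad xi.

Let G := first_form X.
Let xi' := field_coord X xi.
Let xiZ : xi Z = canal_direction z rad s Z.
Proof. by case: xiP => _ E; exact: E. Qed.

Lemma normal_field : mink N (xi Z) = 0.
Proof. by apply/canal_normal_orth; rewrite xiZ; exact: canal_direction_center. Qed.

Lemma field_unit : mink (xi Z) (xi Z) = 1.
Proof. by rewrite xiZ canal_direction_unit. Qed.

Lemma field_center_derive x :
  mink (xi Z) ('d X u x) = (Num.sqrt q)^-1 * mink t ('d X u x).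
Proof.
by rewrite xiZ canal_directionE // minkZl minkDl minkZl chart_center_orth mulr0 addr0.
Qed.

Lemma field_orth_generator x : mink (xi Z) ('d X u x) = 0 -> mink t ('d X u x) = 0.
Proof.
move/eqP; rewrite field_center_derive mulf_eq0 invr_eq0 gt_eqF //=.
by move/eqP.
Qed.

Let dxi : differentiable (xi \o X) u.
Proof. by case: xiP => sxi _; exact: (sxi U X hX [::] u Uu). Qed.

Lemma chart_field : 'd X u (xi' u) = xi Z.
Proof.
apply: etrans (tangent_coordE unitG Uu canal_normal_unit chart_normal_orth pos_u
  chart_tangent (xi (X u))) _.
by rewrite XuE normal_field scale0r addr0.
Qed.

(** The rate [R' / (R |t - R' N|)] at which [xi] rotates along a generator. *)
Definition canal_k : R := dr / (rad s * Num.sqrt q).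

(** Along a generator the center and the radius are fixed, and the field is an
    affine function of the position. *)
Lemma derive_field_generator x : mink (xi Z) ('d X u x) = 0 ->
  'D_x (xi \o X) u = canal_k *: 'd X u x.
Proof.
move=> /field_orth_generator tx.
have [w [w0 wU dw]] := generator_lift tx.
have [_ E1] := is_derive_along w0 dw dxi.
have D0 := is_deriveB (is_derive_along w0 dw dX) (is_derive_cst (z s) (0 : R) (1 : R)).
have D1 := is_deriveD (is_derive_cst t (0 : R) (1 : R)) (is_deriveZ (dr / rad s) D0).
have [_ D2] := is_deriveZ (Num.sqrt q)^-1 D1.
apply: etrans (esym E1) _.
apply: etrans (_ : (Num.sqrt q)^-1 *: (0 + (dr / rad s) *: ('D_x X u - 0)) = _); last first.
  rewrite add0r subr0 scalerA (deriveE _ dX); congr (_ *: _).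
  by rewrite [LHS]mulrC /canal_k invfM mulrA.
apply: etrans _ D2; apply: near_eq_derive; apply: filterS wU => a [Ua Sa] /=.
have -> : xi (X (w a)) = canal_direction z rad s (X (w a)) by case: xiP => _ E; exact: E.
exact: canal_directionE.
Qed.

Lemma levi_civita_field x : metric_ip G u (xi' u) x = 0 ->
  levi_civita G x xi' u = canal_k *: x.
Proof.
rewrite metric_ip_first_form chart_field => xx.
apply: injX; rewrite linearZ.
have dY : derivable (xi \o X) u x by exact: diff_derivable.
have dV : derivable xi' u x by exact: (derivable_tangent_coord oU sX unitG Uu dY).
apply: (tangent_eq pos_u chart_tangent) => [q0|]; last first.
  by rewrite minkZr chart_normal_orth mulr0.
have DF : is_derive u x (fun v => mink ('d X v (xi' v)) ('d X v q0))
    (mink ('D_x (xi \o X) u) ('d X u q0) + mink (xi (X u)) ('D_x ('D_q0 X) u)).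
  apply: is_derive_near_eq (is_derive_mink (derivableP dY) (is_derive_param1 oU sX x q0 Uu)).
  apply: filterS (open_nbhs_nbhs (conj oU Uu)) => v Uv.
  by apply: esym; exact: (tangent_coordP _ _ (unitG Uv)).
apply: etrans (levi_civitaP oU sX unitG Uu dV DF) _.
by rewrite chart_field XuE addrK derive_field_generator.
Qed.

Let h := second_form X u N.
Let lam := (rad s)^-1.

(** The second fundamental form is umbilic on the generator, and its symmetry
    makes the direction of [xi] principal. *)
Lemma second_formE x p :
  h x p = lam * mink ('d X u x) ('d X u p)
    + (h (xi' u) (xi' u) - lam) * (mink (xi Z) ('d X u x) * mink (xi Z) ('d X u p)).
Proof.
pose eta v := mink (xi Z) ('d X u v).
pose o v := v - eta v *: xi' u.
have oE v : 'd X u (o v) = 'd X u v - eta v *: xi Z.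
  by rewrite linearB linearZ chart_field.
have oorth v : mink t ('d X u (o v)) = 0.
  apply: field_orth_generator.
  by rewrite oE minkDr minkNr minkZr field_unit mulr1 subrr.
have split v p' : h v p' = h (o v) p' + eta v * h (xi' u) p'.
  apply: etrans (congr1 (fun c => h c p') (esym (subrK (eta v *: xi' u) v))) _.
  apply: etrans (second_formD sX N Uu _ _ _) _.
  exact: (congr1 (fun c => h (o v) p' + c) (second_formZ sX N Uu _ _ _)).
have hC v p' : h v p' = h p' v by exact: (second_formC oU sX N Uu).
have E1 := second_form_generator p (oorth x).
have E2 := second_form_generator (xi' u) (oorth p).
rewrite split (hC (xi' u)) (split p).
apply: etrans (congr2 +%R E1 (congr1 (fun c => eta x * (c + _)) E2)) _.
rewrite !oE !minkDl !minkNl !minkZl chart_field field_unit -/(eta p).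
rewrite (minkC _ (xi Z)) -/(eta p) -/(eta x) /lam.
by ring.
Qed.

Lemma canal_riemann x y' z' w :
  riemann G u x y' z' w
    = - lam ^+ 2 * pi_tensor G u x y' z' w
      + - (lam * (h (xi' u) (xi' u) - lam)) * Phi_tensor G xi' u x y' z' w.
Proof.
apply: etrans (gauss_equation oU sX unitG Uu canal_normal_unit chart_normal_orth pos_u
  chart_tangent x y' z' w) _.
have E a b := second_formE a b.
apply: etrans (congr2 (fun a b => a - b) (congr2 *%R (E x z') (E y' w))
  (congr2 *%R (E y' z') (E x w))) _.
rewrite /pi_tensor /Phi_tensor !metric_ip_first_form chart_field.
by ring.
Qed.

(** Expressed by the derivative of the ambient field, the last principal
    curvature no longer involves the second derivatives of the chart. *)
Lemma second_form_field :
  (forall v, U v -> 'd X v (xi' v) = xi (X v)) ->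
  h (xi' u) (xi' u) = mink N ('D_(xi' u) (xi \o X) u).
Proof.
move=> E.
have dY : derivable (xi \o X) u (xi' u) by exact: diff_derivable.
have dV : derivable xi' u (xi' u) by exact: (derivable_tangent_coord oU sX unitG Uu dY).
have [_ D] := is_derive_tangent_field oU sX Uu dV.
have <- : 'D_(xi' u) (fun v => 'd X v (xi' v)) u = 'D_(xi' u) (xi \o X) u.
  apply: near_eq_derive.
  by apply: filterS (open_nbhs_nbhs (conj oU Uu)) => v; exact: E.
apply: esym; apply: etrans (congr1 (mink N) D) _.
by rewrite minkDr chart_normal_orth add0r.
Qed.

(** With [q = t^2 + R'^2], the sum is [- t^2 / (R^2 q)], so the sign is decided
    by the causal character of the curve of centers. *)
Lemma canal_k_lt : - lam ^+ 2 + canal_k ^+ 2 < 0.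
Proof.
have q0 : q != 0 by rewrite gt_eqF // direction_norm2_gt0.
have kE : canal_k ^+ 2 = lam ^+ 2 * (dr ^+ 2 / q).
  rewrite /canal_k /lam expr_div_n exprMn sqr_sqrtr ?(ltW direction_norm2_gt0) //.
  by rewrite exprVn invfM mulrCA.
have -> : - lam ^+ 2 + canal_k ^+ 2 = - (lam ^+ 2 * (mink t t / q)).
  have -> : mink t t = q - dr ^+ 2 by rewrite /q /direction_norm2 addrK.
  by rewrite kE mulrBl divff // mulrBr mulr1 opprB addrC.
by rewrite oppr_lt0 mulr_gt0 // ?exprn_gt0 ?invr_gt0 // divr_gt0 // direction_norm2_gt0.
Qed.

End Field.
End Chart.
End CanalPoint.

(** * Sectional curvature and angle with the field *)

Section AnglePlane.
Variables (R : realType) (n : nat) (X : 'rV[R]_n -> 'rV[R]_n.+1) (u : 'rV[R]_n).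
Hypothesis pos_u : forall x, x != 0 -> 0 < mink ('d X u x) ('d X u x).
Variable xi' : 'rV[R]_n -> 'rV[R]_n.
Hypothesis unit_xi : metric_ip (first_form X) u (xi' u) (xi' u) = 1.

Let G := first_form X.
Let eta := metric_ip G u (xi' u).

Lemma sectional_eta (a b : R) x y :
  (forall x y z w, riemann G u x y z w
     = a * pi_tensor G u x y z w + b * Phi_tensor G xi' u x y z w) ->
  orthonormal_pair G u x y ->
  sectional G u x y = a + b * (eta x ^+ 2 + eta y ^+ 2).
Proof.
move=> RE [xx yy xy].
have yx : metric_ip G u y x = 0.
  by rewrite metric_ip_first_form minkC -metric_ip_first_form.
rewrite /sectional RE /pi_tensor /Phi_tensor -/(eta x) -/(eta y) xx yy xy yx.
by ring.
Qed.

(** Bessel's inequality keeps the length of the projection of [xi] in the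
    interval where the arc cosine is injective. *)
Lemma plane_angle_eta x y x' y' :
  orthonormal_pair G u x y -> orthonormal_pair G u x' y' ->
  plane_angle G xi' u x y = plane_angle G xi' u x' y' ->
  eta x ^+ 2 + eta y ^+ 2 = eta x' ^+ 2 + eta y' ^+ 2.
Proof.
have proj v w : orthonormal_pair G u v w ->
    let p := eta v *: v + eta w *: w in
    metric_ip G u p p = eta v ^+ 2 + eta w ^+ 2 /\ eta v ^+ 2 + eta w ^+ 2 <= 1.
  case=> vv ww vw p.
  move: vv ww vw unit_xi; rewrite /G !metric_ip_first_form => vv ww vw xx.
  have ev : eta v = mink ('d X u (xi' u)) ('d X u v) by rewrite /eta metric_ip_first_form.
  have ew : eta w = mink ('d X u (xi' u)) ('d X u w) by rewrite /eta metric_ip_first_form.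
  have pE : 'd X u p = eta v *: 'd X u v + eta w *: 'd X u w.
    by rewrite linearD !linearZ.
  have pp : mink ('d X u p) ('d X u p) = eta v ^+ 2 + eta w ^+ 2.
    rewrite pE minkDl !minkDr !minkZl !minkZr vv ww vw (minkC ('d X u w)) vw.
    by ring.
  have xp : mink ('d X u (xi' u)) ('d X u p) = eta v ^+ 2 + eta w ^+ 2.
    by rewrite pE minkDr !minkZr -ev -ew.
  split => //.
  have : 0 <= mink ('d X u (xi' u - p)) ('d X u (xi' u - p)).
    have [->|/pos_u/ltW //] := eqVneq (xi' u - p) 0.
    by rewrite linear0 mink0l.
  rewrite linearB minkDl !minkDr !minkNl !minkNr opprK.
  rewrite (minkC ('d X u p) ('d X u (xi' u))) xx xp pp; lra.
move=> /proj [pE p1] /proj [pE' p1']; rewrite /plane_angle -/(eta x) -/(eta y) -/(eta x') -/(eta y').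
rewrite pE pE' => /(congr1 cos).
have s0 (c d : R) : 0 <= c ^+ 2 + d ^+ 2 by rewrite addr_ge0 // sqr_ge0.
have mem (c d : R) : c ^+ 2 + d ^+ 2 <= 1 -> -1 <= Num.sqrt (c ^+ 2 + d ^+ 2) <= 1.
  move=> cd; rewrite (le_trans _ (sqrtr_ge0 _)) ?oppr_le0 //=.
  by rewrite -sqrtr1 ler_sqrt.
rewrite !acosK ?in_itv /= ?mem // => /(congr1 (fun c => c ^+ 2)).
by rewrite !sqr_sqrtr.
Qed.

End AnglePlane.

(** * The curvature of canal hypersurfaces of hyperbolic type *)

Theorem proposition3p9 (R : realType) (n : nat) (M : set 'rV[R]_n.+1)
    (J : set R) (S : R -> set 'rV[R]_n.+1) (z : R -> 'rV[R]_n.+1)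
    (rad : R -> R) (xi : 'rV[R]_n.+1 -> 'rV[R]_n.+1) :
  (4 <= n)%N ->
  canal_hypersurface M J S z rad ->
  hyperbolic_type J z ->
  canal_field M J S z rad xi ->
  QC_manifold M xi /\
  exists a b k : 'rV[R]_n.+1 -> R,
    QC_functions M xi a b k /\
    forall p, M p -> a p + k p ^+ 2 < 0.
Proof.
move=> _ canalM hypM xiP.
have hM := canal_spacelike canalM.
have genP p : exists s, M p -> J s /\ S s p.
  have [|nMp] := pselect (M p); last by exists 0.
  by rewrite {1}(canal_generators canalM) => -[s Js Sp]; exists s.
have [sg sgP] := choice genP.
have fieldU U X : local_param M U X -> forall v, U v ->
    'd X v (field_coord X xi v) = xi (X v).
  move=> hX v Uv; have [Js Sp] := sgP _ (local_param_mem hX Uv).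
  exact: (chart_field canalM Js Sp hX Uv erefl xiP).
(* The derivative of xi in its own direction, which is the same in every
   parametrization, determines the remaining principal curvature. *)
have accP p : exists A, forall U X u x, local_param M U X -> U u -> X u = p ->
    'd X u x = xi p -> 'D_x (xi \o X) u = A.
  have [[A [U0 [X0 [u0 [x0 [h0 Uu0 E0 d0 DA]]]]]]|no] := pselect (exists A U X u x,
    [/\ local_param M U X, U u, X u = p, 'd X u x = xi p & 'D_x (xi \o X) u = A]).
    exists A => U X u x hX Uu E d; apply: etrans _ DA.
    exact: (derive_field_param (proj1 xiP) hX Uu h0 Uu0 (etrans E (esym E0))
      (etrans d (esym d0))).
  exists 0 => U X u x hX Uu E d; case: no.
  by exists ('D_x (xi \o X) u), U, X, u, x.
have [acc accE] := choice accP.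
pose lam p := (rad (sg p))^-1.
pose N p := canal_unit_normal z rad (sg p) p.
pose a p := - lam p ^+ 2.
pose b p := - (lam p * (mink (N p) (acc p) - lam p)).
pose k p := canal_k z rad (sg p).
have QCf : QC_functions M xi a b k.
  move=> U X u hX Uu; have [Js Sp] := sgP _ (local_param_mem hX Uu).
  split=> [x y w v|x]; last exact: (levi_civita_field canalM hypM Js Sp hX Uu erefl xiP).
  have E := second_form_field canalM Js Sp hX Uu erefl xiP (fieldU U X hX).
  have A := accE _ U X u _ hX Uu erefl (fieldU U X hX u Uu).
  have R1 := canal_riemann canalM hypM Js Sp hX Uu erefl xiP x y w v.
  apply: etrans R1 _; congr (_ + - (_ * (_ - _)) * _).
  by apply: etrans E _; congr (mink _ _); exact: A.
split; last first.
  exists a, b, k; split=> // p Mp; have [Js Sp] := sgP _ Mp.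
  exact: (canal_k_lt canalM hypM Js).
split=> //.
  split=> [|p Mp]; first exact: (proj1 xiP).
  have [Js Sp] := sgP _ Mp.
  have [U [X [hX [u Uu XuE]]]] := hM.1 p Mp.
  split; last exact: (field_unit canalM hypM Js Sp xiP).
  exists U, X, u, (field_coord X xi u); split=> //.
  by apply: etrans (fieldU U X hX u Uu) _; rewrite XuE.
move=> U X u hX Uu G xi' x y x' y' oxy oxy' angle.
have [RE _] := QCf U X u hX Uu.
have pos_u v : v != 0 -> 0 < mink ('d X u v) ('d X u v).
  exact: (local_param_pos hM hX Uu).
have [Js Sp] := sgP _ (local_param_mem hX Uu).
have unit_xi : metric_ip G u (xi' u) (xi' u) = 1.
  apply: etrans (metric_ip_first_form _ _ _ _) _.
  apply: etrans (congr2 (@mink R n) (fieldU U X hX u Uu) (fieldU U X hX u Uu)) _.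
  exact: (field_unit canalM hypM Js Sp xiP).
rewrite (sectional_eta RE oxy) (sectional_eta RE oxy').
by rewrite (plane_angle_eta pos_u unit_xi oxy oxy' angle).
Qed.
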